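(* Let $R=(r_{i,j})_{i,j\in\mathbb{Z}}$ be the matrix of the operator $\mathcal{H}_{\mathrm S}$ in the monomial basis, $\mathcal{H}_{\mathrm S}\,x^i=\sum_jr_{i,j}\,x^j$. Under the limit $q=e^h$, $d_i=q^{m_i}$ ($1\le i\le4$), $h\to0$ with $m_i$ and $\Lambda$ fixed, one has $$R=1+hR^{(1)}+O(h^2),$$ where $R^{(1)}$ is a tridiagonal matrix (generically infinite-dimensional). Furthermore, if $m_1=-m$ or $m_2=-m$, and $m_3=-n$ or $m_4=-n$, for some $m,n\in\mathbb{Z}_{\ge0}$, then $R^{(1)}$ can be truncated to a finite matrix of size $m+n+1$, namely to the block with indices $-n\le i,j\le m$ (that is, $R^{(1)}_{i,j}=0$ for $-n\le i\le m$ and $j\notin[-n,m]$).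
   Context: $\varphi(z)=(z;q)_\infty=\prod_{k\ge0}(1-zq^k)$; $\mathcal B$ is the linear operator $\mathcal B\,x^k=q^{k(k+1)/2}x^k$, and $$\mathcal{H}_{\mathrm S}=\frac{1}{\varphi(qx)\varphi(\Lambda/x)}\cdot\mathcal{B}\cdot\frac{\varphi(\Lambda)\,\varphi(q^{-1}d_1d_2d_3d_4\Lambda)}{\varphi(-d_1x)\varphi(-d_2x)\varphi(-d_3\Lambda/x)\varphi(-d_4\Lambda/x)}\cdot\mathcal{B}\cdot\frac{1}{\varphi(q^{-1}d_1d_2x)\varphi(d_3d_4\Lambda/x)},$$ where functions act by multiplication and are expanded as power series in $x$ and $\Lambda/x$; the entries $r_{i,j}$ are thus power series in $\Lambda$, and the expansion in $h$ is understood entrywise (coefficientwise in $\Lambda$). ''Tridiagonal'' means $R^{(1)}_{i,j}=0$ for $|i-j|>1$. *)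

(* Defs.v *)
From HB Require Import structures.
From mathcomp Require Export all_boot all_order all_algebra.
From mathcomp Require Export complex.
From mathcomp Require Export all_classical all_reals all_analysis.
Export Order.TTheory GRing.Theory Num.Theory numFieldNormedType.Exports.

Set Implicit Arguments.
Unset Strict Implicit.
Unset Printing Implicit Defensive.

Local Open Scope ring_scope.
Local Open Scope classical_set_scope.

Section Operators.
Variable K : numFieldType.

(* A univariate series \sum_n f_n z^n is [f : nat -> K]. *)

Definition ps_one : nat -> K := fun n => (n == 0%N)%:R.

Definition ps_mul (f g : nat -> K) : nat -> K :=
  fun n => \sum_(i < n.+1) f i * g (n - i)%N.

Definition ps_exp (f : nat -> K) (k : nat) : nat -> K :=
  iter k (ps_mul f) ps_one.

(* 1/f for f_0 = 1, as the geometric series \sum_k (1 - f)^k; only the terms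
   k <= n contribute to the coefficient of z^n. *)
Definition ps_inv (f : nat -> K) : nat -> K :=
  fun n => \sum_(k < n.+1) ps_exp (fun l => ps_one l - f l) k n.

(* Taylor coefficients of \prod_(k >= 0) (1 - z q^k), as limits of those of the
   finite products; meaningful for |q| < 1. *)
Definition phi (q : K) : nat -> K := fun n =>
  lim ((\prod_(k < N) (1 - q ^+ k *: 'X) : {poly K})`_n @[N --> \oo]).

Definition phiV (q : K) : nat -> K := ps_inv (phi q).

(* [g : nat -> nat -> K] stands for \sum_(a, b) g_(a,b) x^a (L/x)^b. *)

Definition ps2_mul (f g : nat -> nat -> K) : nat -> nat -> K :=
  fun a b => \sum_(i < a.+1) \sum_(j < b.+1) f i j * g (a - i)%N (b - j)%N.

(* f(c x), f(c L/x) and f(c L), the last one using L = x (L/x). *)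
Definition at_x (f : nat -> K) (c : K) : nat -> nat -> K :=
  fun a b => if b == 0%N then f a * c ^+ a else 0.

Definition at_Lx (f : nat -> K) (c : K) : nat -> nat -> K :=
  fun a b => if a == 0%N then f b * c ^+ b else 0.

Definition at_L (f : nat -> K) (c : K) : nat -> nat -> K :=
  fun a b => if a == b then f a * c ^+ a else 0.

(* [F : int -> nat -> K] stands for \sum_(j, k) F_(j,k) x^j L^k. *)

Definition xpow (i : int) : int -> nat -> K :=
  fun j k => ((j == i) && (k == 0%N))%:R.

(* Multiplication by \sum_(a, b) g_(a,b) x^a (L/x)^b, using
   x^a (L/x)^b = x^(a - b) L^b.  The sum is a finite-support sum; its support is
   finite as soon as F_(j,k) = 0 for j < i - k, for some i, and this condition
   holds for x^i and is preserved by [mulop g] and [Bop q]. *)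
Definition mulop (g : nat -> nat -> K) (F : int -> nat -> K) :
    int -> nat -> K := fun j k =>
  \sum_(ab \in [set ab : nat * nat | (ab.2 <= k)%N])
    g ab.1 ab.2 * F (j - ab.1%:Z + ab.2%:Z) (k - ab.2)%N.

Definition Bop (q : K) (F : int -> nat -> K) : int -> nat -> K :=
  fun j k => q ^ (j * (j + 1) %/ 2)%Z * F j k.

Definition left_factor (q : K) : nat -> nat -> K :=
  ps2_mul (at_x (phiV q) q) (at_Lx (phiV q) 1).

Definition middle_factor (q d1 d2 d3 d4 : K) : nat -> nat -> K :=
  ps2_mul
    (ps2_mul (at_L (phi q) 1) (at_L (phi q) (q^-1 * d1 * d2 * d3 * d4)))
    (ps2_mul
       (ps2_mul (at_x (phiV q) (- d1)) (at_x (phiV q) (- d2)))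
       (ps2_mul (at_Lx (phiV q) (- d3)) (at_Lx (phiV q) (- d4)))).

Definition right_factor (q d1 d2 d3 d4 : K) : nat -> nat -> K :=
  ps2_mul (at_x (phiV q) (q^-1 * d1 * d2)) (at_Lx (phiV q) (d3 * d4)).

Definition HS (q d1 d2 d3 d4 : K) (F : int -> nat -> K) : int -> nat -> K :=
  mulop (left_factor q)
    (Bop q
       (mulop (middle_factor q d1 d2 d3 d4)
          (Bop q
             (mulop (right_factor q d1 d2 d3 d4) F)))).

(* [HS_matrix q d1 d2 d3 d4 i j k] is the coefficient of L^k in r_(i,j), where
   HS x^i = \sum_j r_(i,j) x^j. *)
Definition HS_matrix (q d1 d2 d3 d4 : K) (i j : int) : nat -> K :=
  HS q d1 d2 d3 d4 (xpow i) j.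

End Operators.

Definition expC (R : realType) (z : R[i]) : R[i] :=
  Complex (expR (complex.Re z) * cos (complex.Im z))
          (expR (complex.Re z) * sin (complex.Im z)).

(* Matrices indexed by int with entries in power series in L: [A i j k] is the
   coefficient of L^k in the entry (i, j). *)

Definition id_matrix (K : numFieldType) (i j : int) (k : nat) : K :=
  ((i == j) && (k == 0%N))%:R.

Definition tridiagonal (K : numFieldType) (A : int -> int -> nat -> K) : Prop :=
  forall i j : int, 1 < `|i - j| -> forall k, A i j k = 0.

(* The rows of A indexed by I have no entries outside the columns indexed by I,
   i.e. A can be truncated to the block I x I. *)
Definition truncates_to (K : numFieldType) (A : int -> int -> nat -> K)
    (I : {pred int}) : Prop :=
  forall i j : int, i \in I -> j \notin I -> forall k, A i j k = 0.

(* Main.v *)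
(* Write y = L/x, so that HS x^i = x^i H_i with H_i in K[[x, y]], and let B_i be
   the operator B seen on K[[x, y]] through x^i.  Since the quotients
   phi(cz)/phi(dz) are given by the q-binomial theorem, one has Heine's identity
     B_i [phi(ab L) / (phi(ax) phi(by))]
       = q^(i(i+1)/2) phi(- q^(i+1) a x) phi(- q^(-i) b y).
   Let T_i f be the left factor times B_i [phi(L) f / (phi(-x) phi(-y))].  By the
   identity, H_i = T_i S_i and T_i U_i = 1, where S_i and U_i are products of
   series in x and in y whose coefficients stay bounded when h -> 0, although
   those of phi have poles; moreover T_i (x f) = x T_(i+1) f,
   T_i (y f) = y T_(i-1) f, and T_i 1 has bounded coefficients, so that T_i
   preserves O(h^2).  It remains to compare explicit expansions:
     S_i = U_i + h (i(i+1) U_i + (- u x U_(i+1) - d y U_(i-1) + (u + d) L U_i)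
           / (1 - L)) + O(h^2)
   with u = (i + m1)(i + m2) and d = (i - m3)(i - m4), and applying T_i yields
     H_i = 1 + h (i(i+1) + (- u x - d y + (u + d) L) / (1 - L)) + O(h^2). *)

From HB Require Import structures.
From mathcomp Require Import ring lra zify.
Require Import Defs.

Set Implicit Arguments.
Unset Strict Implicit.
Unset Printing Implicit Defensive.

Local Open Scope ring_scope.

(** * Formal power series and the q-binomial theorem *)

(** The wrapper keeps the Cauchy product apart from the pointwise product on functions. *)
Record fps (A : Type) := Fps { coefs :> nat -> A }.

Lemma fpsP (A : Type) (f g : fps A) : (forall n, f n = g n) -> f = g.
Proof. by case: f g => [f] [g] /= fg; congr Fps; apply/funext. Qed.

HB.instance Definition _ (A : Type) := gen_eqMixin (fps A).
HB.instance Definition _ (A : Type) := gen_choiceMixin (fps A).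

Section FpsRing.
Variable A : comNzRingType.
Implicit Types f g k : fps A.

Definition fps_zero : fps A := Fps (fun=> 0).
Definition fps_opp f : fps A := Fps (fun n => - f n).
Definition fps_add f g : fps A := Fps (fun n => f n + g n).
Definition fps_one : fps A := Fps (fun n => (n == 0%N)%:R).
Definition fps_mul f g : fps A :=
  Fps (fun n => \sum_(i < n.+1) f i * g (n - i)%N).

Fact fps_addA : associative fps_add.
Proof. by move=> f g k; apply: fpsP => n /=; rewrite addrA. Qed.
Fact fps_addC : commutative fps_add.
Proof. by move=> f g; apply: fpsP => n /=; rewrite addrC. Qed.
Fact fps_add0 : left_id fps_zero fps_add.
Proof. by move=> f; apply: fpsP => n /=; rewrite add0r. Qed.
Fact fps_addN : left_inverse fps_zero fps_opp fps_add.
Proof. by move=> f; apply: fpsP => n /=; rewrite addNr. Qed.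

HB.instance Definition _ :=
  GRing.isZmodule.Build (fps A) fps_addA fps_addC fps_add0 fps_addN.

(** Each coefficient of a product sees only finitely many coefficients of the factors, so
    commutativity and associativity are inherited from polynomials. *)
Lemma fps_mul_poly N f g n : (n < N)%N ->
  fps_mul f g n = ((\poly_(i < N) f i) * (\poly_(i < N) g i))`_n.
Proof.
move=> nN; rewrite coefM /=; apply: eq_bigr => i _.
by rewrite !coef_poly !ifT //; have := ltn_ord i; lia.
Qed.

Fact fps_mulC : commutative fps_mul.
Proof. by move=> f g; apply: fpsP => n;
  rewrite !(fps_mul_poly (N := n.+1)) // mulrC. Qed.

Fact fps_mulA : associative fps_mul.
Proof.
move=> f g k; apply: fpsP => n.
pose P (u : fps A) : {poly A} := \poly_(i < n.+1) u i.
have E (u : fps A) i : (i < n.+1)%N -> u i = (P u)`_i by move=> h; rewrite coef_poly h.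
transitivity ((P f * (P g * P k))`_n).
  rewrite coefM; apply: eq_bigr => i _.
  by rewrite (E f) // (@fps_mul_poly n.+1) //; have := ltn_ord i; lia.
rewrite mulrA coefM; apply: eq_bigr => i _.
by rewrite (E k) ?(@fps_mul_poly n.+1) //; have := ltn_ord i; lia.
Qed.

Fact fps_mul1 : left_id fps_one fps_mul.
Proof.
move=> f; apply: fpsP => n /=; rewrite big_ord_recl /= mul1r subn0.
by rewrite big1 ?addr0 // => i _; rewrite mul0r.
Qed.

Fact fps_mulDl : left_distributive fps_mul fps_add.
Proof.
move=> f g k; apply: fpsP => n /=; rewrite -big_split /=.
by apply: eq_bigr => i _; rewrite mulrDl.
Qed.

Fact fps_one_neq0 : fps_one != 0.
Proof.
by apply/eqP => /(congr1 (fun f : fps A => f 0%N)) /= /eqP; rewrite oner_eq0.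
Qed.

HB.instance Definition _ := GRing.Zmodule_isComNzRing.Build (fps A)
  fps_mulA fps_mulC fps_mul1 fps_mulDl fps_one_neq0.

Lemma coefsD f g n : (f + g) n = f n + g n. Proof. by []. Qed.
Lemma coefsN f n : (- f) n = - f n. Proof. by []. Qed.
Lemma coefsM f g n : (f * g) n = \sum_(i < n.+1) f i * g (n - i)%N. Proof. by []. Qed.
Lemma coefs1 n : (1 : fps A) n = (n == 0%N)%:R. Proof. by []. Qed.
Lemma coefs0 n : (0 : fps A) n = 0. Proof. by []. Qed.
Lemma coefs_sum (I : Type) (r : seq I) (P : pred I) (F : I -> fps A) n :
  (\sum_(i <- r | P i) F i) n = \sum_(i <- r | P i) F i n.
Proof. by elim/big_rec2: _ => // i y z _ <-. Qed.

Definition fpsC (c : A) : fps A := Fps (fun n => if n == 0%N then c else 0).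

Lemma coefsCM c f n : (fpsC c * f) n = c * f n.
Proof.
rewrite coefsM big_ord_recl /= subn0 big1 ?addr0 // => i _.
by rewrite mul0r.
Qed.

Fact fpsC_zmod : zmod_morphism fpsC.
Proof. by move=> a b; apply: fpsP => -[|n]; rewrite coefsD coefsN /= ?subr0. Qed.
Fact fpsC_monoid : monoid_morphism fpsC.
Proof.
split; first by apply: fpsP => -[|n].
by move=> a b; apply: fpsP => n; rewrite coefsCM /=; case: eqP => // _; rewrite mulr0.
Qed.
HB.instance Definition _ := GRing.isZmodMorphism.Build A (fps A) fpsC fpsC_zmod.
HB.instance Definition _ := GRing.isMonoidMorphism.Build A (fps A) fpsC fpsC_monoid.

Definition fpsX : fps A := Fps (fun n => (n == 1%N)%:R).

Lemma coefsXM f n : (fpsX * f) n = if n is m.+1 then f m else 0.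
Proof.
case: n => [|n]; rewrite coefsM; first by rewrite big_ord1 /= mul0r.
rewrite big_ord_recl /= mul0r add0r big_ord_recl /= subSS subn0 mul1r.
by rewrite big1 ?addr0 // => i _; rewrite mul0r.
Qed.

Definition fps_scale (q : A) f : fps A := Fps (fun n => q ^+ n * f n).

Lemma fps_scaleE q f n : fps_scale q f n = q ^+ n * f n. Proof. by []. Qed.

Lemma fps_scaleM q f g : fps_scale q (f * g) = fps_scale q f * fps_scale q g.
Proof.
apply: fpsP => n; rewrite coefsM fps_scaleE coefsM mulr_sumr; apply: eq_bigr => i _ /=.
rewrite mulrACA -exprD subnKC //; have := ltn_ord i; lia.
Qed.

Definition fps_geom (d : A) : fps A := Fps (fun n => d ^+ n).

Lemma fps_geomK d : (1 - fpsC d * fpsX) * fps_geom d = 1.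
Proof.
apply: fpsP => n; rewrite mulrBl mul1r -mulrA coefsD coefsN coefsCM coefsXM.
by case: n => [|n] /=; rewrite ?mulr0 ?subr0 // -exprS subrr.
Qed.

End FpsRing.

Lemma fps_mul_geomI (A : comNzRingType) (d : A) (f g : fps A) :
  (1 - fpsC d * fpsX A) * f = (1 - fpsC d * fpsX A) * g -> f = g.
Proof.
move=> /(congr1 (fun u => fps_geom d * u)).
by rewrite !mulrA ![fps_geom d * _]mulrC fps_geomK !mul1r.
Qed.

Section QBinomial.
Variables (A : comNzRingType) (q : A) (v : nat -> A).
Hypothesis vK : forall n, (1 - q ^+ n.+1) * v n = 1.

(** This is phi(cz)/phi(dz), expanded by the q-binomial theorem. The coefficient ring is arbitrary
    because both K and K[[y]] are used below. *)
Definition qbin (c d : A) : fps A :=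
  Fps (fun n => \prod_(s < n) ((d - c * q ^+ s) * v s)).

Lemma qbinS c d n : (1 - q ^+ n.+1) * qbin c d n.+1 = (d - c * q ^+ n) * qbin c d n.
Proof.
rewrite /= big_ord_recr /=.
by rewrite mulrCA [(1 - _) * _]mulrCA vK mulr1 mulrC.
Qed.

(** The relation (1 - dz) f(z) = (1 - cz) f(qz) is characteristic of phi(cz)/phi(dz);
    coefficientwise it is the recursion [qbinS]. *)
Lemma qbin_func c d :
  (1 - fpsC d * fpsX A) * qbin c d = (1 - fpsC c * fpsX A) * fps_scale q (qbin c d).
Proof.
apply: fpsP => -[|n]; rewrite !mulrBl !mul1r -!mulrA !coefsD !coefsN !coefsCM !coefsXM.
  by rewrite fps_scaleE expr0 mul1r !mulr0.
have := qbinS c d n.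
rewrite !fps_scaleE.
move: (qbin c d n.+1) (qbin c d n) => u w; rewrite mulrBl mul1r => E.
apply: subr0_eq.
by transitivity (u - q ^+ n.+1 * u - (d - c * q ^+ n) * w); [ring | rewrite E subrr].
Qed.

(** The coefficient of z^(n+1) in the functional equation determines f_(n+1) from f_n, since 1 -
    q^(n+1) is invertible. *)
Lemma qbin_uniq c d (f : fps A) : f 0%N = 1 ->
  (1 - fpsC d * fpsX A) * f = (1 - fpsC c * fpsX A) * fps_scale q f -> f = qbin c d.
Proof.
move=> f0 Ef; apply: fpsP; elim=> [|n IH]; first by rewrite f0 /= big_ord0.
have : ((1 - fpsC d * fpsX A) * f) n.+1 =
       ((1 - fpsC c * fpsX A) * fps_scale q f) n.+1 by rewrite Ef.
rewrite !mulrBl !mul1r -!mulrA !coefsD !coefsN !coefsCM !coefsXM !fps_scaleE => En.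
have En' : (1 - q ^+ n.+1) * f n.+1 = (d - c * q ^+ n) * f n.
  apply: subr0_eq; move/eqP: En; rewrite -subr_eq0 => /eqP <-.
  by ring.
have -> : f n.+1 = v n * ((1 - q ^+ n.+1) * f n.+1).
  by rewrite mulrA [v n * _]mulrC vK mul1r.
by rewrite En' IH -qbinS mulrA [v n * _]mulrC vK mul1r.
Qed.

(** Quotients telescope: the product of the two functional equations is that of phi(cz)/phi(ez), up
    to the cancellable factor 1 - dz. *)
Lemma qbinM c d e : qbin c d * qbin d e = qbin c e.
Proof.
apply: qbin_uniq; first by rewrite coefsM big_ord1 /= !big_ord0 mulr1.
apply: (@fps_mul_geomI _ d); rewrite fps_scaleM.
have E1 := qbin_func c d; have E2 := qbin_func d e.
transitivity (((1 - fpsC d * fpsX A) * qbin c d) * ((1 - fpsC e * fpsX A) * qbin d e)).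
  by ring.
by rewrite E1 E2; ring.
Qed.

Lemma qbin_id c : qbin c c = 1.
Proof.
apply/esym/qbin_uniq => //; congr (_ * _).
by apply: fpsP => -[|n]; rewrite fps_scaleE coefs1 ?mulr0 ?mulr1.
Qed.

Lemma qbin0_shift d : (1 - fpsC d * fpsX A) * qbin 0 d = qbin 0 (d * q).
Proof.
rewrite qbin_func rmorph0 mul0r subr0 mul1r; apply: fpsP => n /=.
elim: n => [|n IH]; first by rewrite !big_ord0 mulr1.
rewrite !big_ord_recr /= -IH; move: (\prod_(i < n) _) => p.
by rewrite exprSr; ring.
Qed.

End QBinomial.

(** * Series in x and L/x, and the Gaussian operator *)

Definition tri (j : int) : int := (j * (j + 1) %/ 2)%Z.

Lemma tri_double j : tri j * 2 = j * (j + 1).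
Proof.
apply: divzK; case: (intP j) => [|n|n].
- by [].
- rewrite -!PoszD -PoszM dvdzE /=; rewrite dvdn2 oddM /=; lia.
have -> : - n.+1%:Z * (- n.+1%:Z + 1) = (n.+1 * n)%:Z by rewrite PoszM -addn1 PoszD;
  ring.
by rewrite dvdzE /= dvdn2 oddM /=; lia.
Qed.

Lemma int_mul2I (a b : int) : a * 2 = b * 2 -> a = b.
Proof. lia. Qed.

(** The only mixed term of the quadratic exponent is -nm. Once the q^(nm) of [heine_coefs] cancels
    it, the Gaussian weight separates into a factor in n and a factor in m. *)
Lemma tri_shift (i : int) (n m : nat) :
  tri (i + n%:Z - m%:Z) + (n * m)%:Z =
  tri i + ((i + 1) * n%:Z + tri (- n%:Z)) + (- i * m%:Z + tri (- m%:Z)).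
Proof. by apply: int_mul2I; rewrite !mulrDl !tri_double PoszM; ring. Qed.

Section TwoVariables.
Variable K : fieldType.
Local Notation S1 := (fps K).
Local Notation S2 := (fps (fps K)).

(** In [S2] the outer variable is x and the inner one is y = L/x. *)
Definition in_x (f : S1) : S2 := Fps (fun a => fpsC (f a)).

Lemma in_xE f a : in_x f a = fpsC (f a). Proof. by []. Qed.

Fact in_x_zmod : zmod_morphism in_x.
Proof. by move=> f g; apply: fpsP => n;
  rewrite coefsD coefsN !in_xE coefsD coefsN rmorphB. Qed.
Fact in_x_monoid : monoid_morphism in_x.
Proof.
split; first by apply: fpsP => n; rewrite in_xE !coefs1 rmorph_nat.
move=> f g; apply: fpsP => n; rewrite in_xE !coefsM rmorph_sum.
by apply: eq_bigr => i _; rewrite rmorphM.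
Qed.
HB.instance Definition _ := GRing.isZmodMorphism.Build S1 S2 in_x in_x_zmod.
HB.instance Definition _ := GRing.isMonoidMorphism.Build S1 S2 in_x in_x_monoid.

Definition in_y (f : S1) : S2 := fpsC f.
HB.instance Definition _ := GRing.RMorphism.copy in_y (@fpsC S1).

Definition in_c (c : K) : S2 := fpsC (fpsC c).
HB.instance Definition _ := GRing.RMorphism.copy in_c (@fpsC _ \o @fpsC K).

Definition in_L (f : S1) : S2 :=
  Fps (fun a => Fps (fun b => if a == b then f a else 0)).

Definition vx : S2 := in_x (fpsX K).
Definition vy : S2 := in_y (fpsX K).

Lemma vxE : vx = fpsX _.
Proof. by apply: fpsP => n; rewrite /vx in_xE /= rmorph_nat. Qed.

Lemma coefs_in_xy f g a b : (in_x f * in_y g) a b = f a * g b.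
Proof. by rewrite mulrC coefsCM in_xE mulrC coefsCM. Qed.

Lemma coefs_in_cM c (f : S2) a b : (in_c c * f) a b = c * f a b.
Proof. by rewrite !coefsCM. Qed.

Lemma coefs_vxM (f : S2) a b : (vx * f) a b = if a is a'.+1 then f a' b else 0.
Proof. by rewrite vxE coefsXM; case: a. Qed.

Lemma coefs_vyM (f : S2) a b : (vy * f) a b = if b is b'.+1 then f a b' else 0.
Proof. by rewrite coefsCM coefsXM. Qed.

Lemma fps2P (f g : S2) : (forall a b, f a b = g a b) -> f = g.
Proof. by move=> fg; do 2!(apply: fpsP => ?); apply: fg. Qed.

Lemma coefs2M (f g : S2) a b :
  (f * g) a b = \sum_(i < a.+1) \sum_(j < b.+1) f i j * g (a - i)%N (b - j)%N.
Proof. by rewrite coefsM coefs_sum. Qed.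

Lemma coefs2D (f g : S2) a b : (f + g) a b = f a b + g a b. Proof. by []. Qed.
Lemma coefs2N (f : S2) a b : (- f) a b = - f a b. Proof. by []. Qed.

Section Gauss.
Variable q : K.

(** The operator B on x^i K[[x, y]]: at fixed L, the monomial x^i x^a y^b has degree i + a - b in
    x. *)
Definition gauss (i : int) (f : S2) : S2 :=
  Fps (fun a => Fps (fun b => q ^ tri (i + a%:Z - b%:Z) * f a b)).

Lemma gaussE i f a b : gauss i f a b = q ^ tri (i + a%:Z - b%:Z) * f a b.
Proof. by []. Qed.

Lemma gaussD i f g : gauss i (f + g) = gauss i f + gauss i g.
Proof. by apply: fps2P => a b; rewrite coefs2D !gaussE coefs2D mulrDr. Qed.

(** A series supported on the diagonal is a series in L = xy alone, and B commutes with L. *)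
Lemma gauss_diag i (g f : S2) : (forall a b, a != b -> g a b = 0) ->
  gauss i (g * f) = g * gauss i f.
Proof.
move=> g0; apply: fps2P => a b; rewrite gaussE !coefs2M mulr_sumr;
  apply: eq_bigr => s _.
rewrite mulr_sumr; apply: eq_bigr => t _; have [st|st] := eqVneq (val s) (val t);
  last first.
  by rewrite g0 // !mul0r mulr0.
rewrite gaussE mulrCA; congr (_ * (_ ^ (tri _) * _)).
by move: (ltn_ord s) (ltn_ord t) st => /=; lia.
Qed.

Lemma gaussC i c f : gauss i (in_c c * f) = in_c c * gauss i f.
Proof. by apply: fps2P => a b; rewrite gaussE !coefs_in_cM gaussE mulrCA. Qed.

Lemma gauss_vx i f : gauss i (vx * f) = vx * gauss (i + 1) f.
Proof.
apply: fps2P => -[|a] b; rewrite gaussE !coefs_vxM ?mulr0 // gaussE;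
  congr (_ ^ (tri _) * _); lia.
Qed.

Lemma gauss_vy i f : gauss i (vy * f) = vy * gauss (i - 1) f.
Proof.
apply: fps2P => a [|b]; rewrite gaussE !coefs_vyM ?mulr0 // gaussE;
  congr (_ ^ (tri _) * _); lia.
Qed.

Definition qinv (n : nat) : K := (1 - q ^+ n.+1)^-1.

Hypothesis q0 : q != 0.
Hypothesis q1 : forall n, q ^+ n.+1 != 1.

Lemma qinvK n : (1 - q ^+ n.+1) * qinv n = 1.
Proof. by rewrite mulfV // subr_eq0 eq_sym. Qed.

Local Notation qb := (qbin q qinv).

Local Notation SA := (fun n => fpsC (qinv n)).
Lemma qinv_fpsK n : (1 - fpsC q ^+ n.+1) * SA n = 1.
Proof. by rewrite -rmorphXn -(rmorph1 (@fpsC K)) -rmorphB -rmorphM qinvK rmorph1. Qed.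

Lemma in_x_qbin c d : in_x (qb c d) = qbin (fpsC q) SA (fpsC c) (fpsC d).
Proof.
apply: fpsP => n; rewrite in_xE /= rmorph_prod; apply: eq_bigr => s _.
by rewrite rmorphM rmorphB rmorphM rmorphXn.
Qed.

Lemma coefsXn n m : (fpsX K ^+ n) m = (m == n)%:R.
Proof. by elim: n m => [|n IH] m; rewrite ?expr0 ?coefs1 // exprS coefsXM; case: m. Qed.

(** Reading phi(cxy) as a series in x with parameter cy in K[[y]] brings it within reach of the
    q-binomial theorem over K[[y]]. *)
Lemma in_L_qbin c : in_L (qb c 0) = qbin (fpsC q) SA (fpsC c * fpsX K) 0.
Proof.
apply: fpsP => n.
have -> : qbin (fpsC q) SA (fpsC c * fpsX K) 0 n = fpsC (qb c 0 n) * fpsX K ^+ n.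
  rewrite /=; elim: n => [|n IH]; first by rewrite !big_ord0 rmorph1 mulr1.
  rewrite !big_ord_recr /= IH; move: (\prod_(i < n) _) => p.
  by rewrite exprSr !(rmorphM, rmorphB, rmorphXn, rmorph0); ring.
apply: fpsP => m; rewrite coefsCM coefsXn [LHS]/= eq_sym.
by case: eqP => _; rewrite ?mulr1 ?mulr0.
Qed.

Definition qfactV n : K := \prod_(s < n) qinv s.

Lemma qbin0E d n : qb 0 d n = d ^+ n * qfactV n.
Proof.
rewrite /= /qfactV; elim: n => [|n IH]; first by rewrite !big_ord0 mulr1.
rewrite !big_ord_recr /= IH exprSr; move: (\prod_(i < n) qinv i) => p.
by ring.
Qed.

Lemma qbinc0E c n : qb c 0 n = (- c) ^+ n * q ^ tri (- n%:Z) * qfactV n.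
Proof.
rewrite /= /qfactV; elim: n => [|n IH]; first by rewrite !big_ord0 !mulr1.
rewrite !big_ord_recr /= IH exprSr; move: (\prod_(i < n) qinv i) => p.
have -> : tri (- n.+1%:Z) = tri (- n%:Z) + n%:Z.
  by apply: int_mul2I; rewrite mulrDl !tri_double -addn1 PoszD; ring.
by rewrite expfzDr // -exprnP; ring.
Qed.

Lemma qbin_prod b n :
  (\prod_(s < n) (1 - fpsC (b * q ^+ s) * fpsX K)) * qb 0 b = qb 0 (b * q ^+ n).
Proof.
elim: n => [|n IH]; first by rewrite big_ord0 mul1r mulr1.
by rewrite big_ord_recr /= mulrAC IH mulrC qbin0_shift ?exprSr ?mulrA //; apply: qinvK.
Qed.

(** Over K[[y]], the coefficient of x^n in phi(abL)/phi(ax) is a^n times the product of the 1 - b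
    q^s y for s < n, over that of the 1 - q^(s+1). Multiplication by 1/phi(by) turns the numerator
    into 1/phi(b q^n y). *)
Lemma heine_coefs a b n m :
  (in_L (qb (a * b) 0) * in_x (qb 0 a) * in_y (qb 0 b)) n m =
  a ^+ n * qfactV n * ((b * q ^+ n) ^+ m * qfactV m).
Proof.
rewrite in_L_qbin in_x_qbin rmorph0 qbinM; last exact: qinv_fpsK.
rewrite mulrC coefsCM -(qbin0E (b * q ^+ n)) -qbin_prod mulrC -coefsCM mulrA.
congr (coefs (_ * _) _); rewrite /= /qfactV; elim: n => [|n IH].
  by rewrite !big_ord0 expr0 mul1r (rmorph1 (@fpsC K)) mul1r.
rewrite !big_ord_recr /= IH exprSr; move: (\prod_(i < n) qinv i) => p.
by rewrite !(rmorphM, rmorphXn); ring.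
Qed.

(** The factor q^(nm) of [heine_coefs] is absorbed by the Gaussian weight through [tri_shift], so
    the double series splits into a series in x times a series in y. *)
Lemma gauss_heine i a b :
  gauss i (in_L (qb (a * b) 0) * in_x (qb 0 a) * in_y (qb 0 b)) =
  in_c (q ^ tri i) * (in_x (qb (- (q ^ (i + 1) * a)) 0) * in_y (qb (- (q ^ (- i) *
    b)) 0)).
Proof.
apply: fps2P => n m; rewrite gaussE heine_coefs coefs_in_cM coefs_in_xy !qbinc0E !opprK.
have E : q ^ tri (i + n%:Z - m%:Z) * q ^+ n ^+ m =
    q ^ tri i * ((q ^ (i + 1)) ^+ n * q ^ tri (- n%:Z)) *
    ((q ^ (- i)) ^+ m * q ^ tri (- m%:Z)).
  by rewrite -exprM !exprnP !exprz_exp -!expfzDr // tri_shift.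
rewrite !exprMn.
transitivity (q ^ tri (i + n%:Z - m%:Z) * q ^+ n ^+ m * (a ^+ n * b ^+ m * qfactV n *
  qfactV m)).
  by ring.
by rewrite E; ring.
Qed.

End Gauss.
End TwoVariables.

(** * Factorisation of the operator *)

Section Operators.
Variable K : fieldType.
Local Notation S1 := (fps K).
Local Notation S2 := (fps (fps K)).
Variable q : K.
Hypothesis q0 : q != 0.
Hypothesis q1 : forall n, q ^+ n.+1 != 1.
Local Notation qb := (qbin q (qinv q)).

Definition leftF : S2 := in_x (qb 0 q) * in_y (qb 0 1).
Definition weightF : S2 := in_L (qb 1 0) * in_x (qb 0 (-1)) * in_y (qb 0 (-1)).
(** The weight phi(L)/(phi(-x) phi(-y)) is split off so that f can be taken with coefficients
    bounded as h -> 0. *)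
Definition opT i (f : S2) : S2 := leftF * gauss q i (weightF * f).
(** Multiplied by the weight, this becomes the input of Heine's identity with a = -q^(-i), b = -q^i
    and ab = 1. *)
Definition serU i : S2 :=
  in_c (q ^ (- tri i)) * in_x (qb (-1) (- q ^ (- i))) * in_y (qb (-1) (- q ^ i)).
Definition rightF d1 d2 d3 d4 : S2 :=
  in_x (qb 0 (q^-1 * d1 * d2)) * in_y (qb 0 (d3 * d4)).
Definition middleF d1 d2 d3 d4 : S2 :=
  (in_L (qb 1 0) * in_L (qb (q^-1 * d1 * d2 * d3 * d4) 0)) *
  ((in_x (qb 0 (- d1)) * in_x (qb 0 (- d2))) * (in_y (qb 0 (- d3)) * in_y (qb 0 (-
    d4)))).
(** What remains of the middle factor times the image of the right factor under B, after division by
    the weight. *)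
Definition serS d1 d2 d3 d4 i : S2 :=
  in_c (q ^ tri i) *
  in_x (qb (- (q ^ i * d1 * d2)) (- d1) * qb (-1) (- d2)) *
  in_y (qb (- (q ^ (- i) * d3 * d4)) (- d3) * qb (-1) (- d4)).

Let qM c d e : qb c d * qb d e = qb c e.
Proof. exact: qbinM (qinvK q1) c d e. Qed.
Let qid c : qb c c = 1.
Proof. exact: qbin_id (qinvK q1) c. Qed.

Lemma opTD i (f g : S2) : opT i (f + g) = opT i f + opT i g.
Proof. by rewrite /opT mulrDr gaussD mulrDr. Qed.

Lemma opT_sub i (f g : S2) : opT i f = opT i g + opT i (f - g).
Proof. by rewrite -opTD addrC subrK. Qed.

Lemma opTC i c (f : S2) : opT i (in_c c * f) = in_c c * opT i f.
Proof. by rewrite /opT [weightF * _]mulrCA gaussC mulrCA. Qed.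

Lemma opT_vx i (f : S2) : opT i (vx K * f) = vx K * opT (i + 1) f.
Proof. by rewrite /opT [weightF * _]mulrCA gauss_vx mulrCA. Qed.

Lemma opT_vy i (f : S2) : opT i (vy K * f) = vy K * opT (i - 1) f.
Proof. by rewrite /opT [weightF * _]mulrCA gauss_vy mulrCA. Qed.

Lemma opT_diag i (g f : S2) : (forall a b, a != b -> g a b = 0) ->
  opT i (g * f) = g * opT i f.
Proof. by move=> g0; rewrite /opT [weightF * _]mulrCA (gauss_diag _ _ _ g0) mulrCA. Qed.

Definition shift_x (f : S2) : S2 := Fps (fun a => f a.+1).
(** Only the pure powers of y are kept, since every monomial containing x already belongs to
    [shift_x]. *)
Definition shift_y (f : S2) : S2 :=
  Fps (fun a => Fps (fun b => if a == 0%N then f 0%N b.+1 else 0)).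

Lemma shift_decomp (f : S2) : f = in_c (f 0%N 0%N) * 1 + (vx K * shift_x f + vy K *
  shift_y f).
Proof.
by apply: fps2P => -[|a] [|b]; rewrite !coefs2D coefs_in_cM coefs_vxM coefs_vyM /=
  ?mulr1 ?mulr0 ?add0r ?addr0.
Qed.

(** Each shift lowers the total degree a + b by one, so any coefficient of [opT i f] reduces to
    coefficients of f and of [opT j 1]. *)
Lemma opT_rec i (f : S2) a b : opT i f a b = f 0%N 0%N * opT i 1 a b +
  ((if a is a'.+1 then opT (i + 1) (shift_x f) a' b else 0) +
   (if b is b'.+1 then opT (i - 1) (shift_y f) a b' else 0)).
Proof. by rewrite {1}[f]shift_decomp !opTD opTC opT_vx opT_vy !coefs2D coefs_in_cM
  coefs_vxM coefs_vyM. Qed.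

(** Heine's identity with a = b = -1. *)
Lemma opT1 i : opT i 1 = in_c (q ^ tri i) * in_x (qb (q ^ (i + 1)) q) * in_y (qb (q ^
  (- i)) 1).
Proof.
rewrite /opT /weightF mulr1.
have := gauss_heine q0 q1 i (-1) (-1); rewrite mulrNN mulr1 !mulrN !mulr1 !opprK => ->.
rewrite /leftF -(qM (q ^ (i + 1)) 0 q) -(qM (q ^ (- i)) 0 1) !rmorphM.
by ring.
Qed.

(** With a = -q^(-i) and b = -q^i, Heine's identity returns phi(qx) phi(y), which the left factor
    cancels. *)
Lemma opT_serU i : opT i (serU i) = 1.
Proof.
rewrite /opT /weightF /serU.
set X := in_x (qb _ (- q ^ (- i))); set Y := in_y (qb _ (- q ^ i)).
have -> : in_L (qb 1 0) * in_x (qb 0 (-1)) * in_y (qb 0 (-1)) * (in_c (q ^ (- tri i))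
  * X * Y) =
  in_c (q ^ (- tri i)) * (in_L (qb 1 0) * (in_x (qb 0 (-1)) * X) * (in_y (qb 0 (-1))
    * Y)).
  by ring.
rewrite /X /Y -!rmorphM !qM gaussC.
have := gauss_heine q0 q1 i (- q ^ (- i)) (- q ^ i).
rewrite mulrNN -expfzDr // addNr expr0z !mulrN !opprK => ->.
rewrite -!expfzDr // addNr expr0z addrAC subrr add0r expr1z /leftF.
set C := in_c _; set C' := in_c _; set A := in_x _; set B := in_y _;
  set A' := in_x _; set B' := in_y _.
transitivity ((C * C') * (A * A') * (B * B')); first by ring.
by rewrite -!rmorphM -expfzDr // addNr expr0z !qM !qid !rmorph1 !mulr1.
Qed.

(** Moving x or y out of [opT] shifts the index, which is why x comes with [serU (i + 1)] and y with
    [serU (i - 1)]: every [serU] is then sent to 1. *)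
Lemma opT_first_order i (c k al be : K) (g : S2) : (forall a b, a != b -> g a b = 0) ->
  opT i (serU i + in_c c * (in_c k * serU i + g * (- in_c al * vx K * serU (i + 1)
     - in_c be * vy K * serU (i - 1) + in_c (al + be) * (vx K * vy K) * serU i))) =
  1 + in_c c * (in_c k + g * (- in_c al * vx K - in_c be * vy K + in_c (al + be) *
    (vx K * vy K))).
Proof.
move=> g0.
have HC e : opT i (in_c e * serU i) = in_c e by rewrite opTC opT_serU mulr1.
have Hx e : opT i (in_c e * (vx K * serU (i + 1))) = in_c e * vx K.
  by rewrite opTC opT_vx opT_serU mulr1.
have Hy e : opT i (in_c e * (vy K * serU (i - 1))) = in_c e * vy K.
  by rewrite opTC opT_vy opT_serU mulr1.
have Hxy e : opT i (in_c e * (vx K * (vy K * serU i))) = in_c e * (vx K * vy K).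
  by rewrite opTC opT_vx opT_vy addrK opT_serU mulr1.
have -> : - in_c al * vx K * serU (i + 1) - in_c be * vy K * serU (i - 1)
    + in_c (al + be) * (vx K * vy K) * serU i =
    in_c (- al) * (vx K * serU (i + 1)) + (in_c (- be) * (vy K * serU (i - 1))
    + in_c (al + be) * (vx K * (vy K * serU i))).
  by rewrite !rmorphN; move: (serU _) (serU _) (serU _) => u u1 u2; ring.
rewrite opTD opT_serU opTC opTD HC opT_diag // opTD Hx opTD Hy Hxy !rmorphN.
by ring.
Qed.

(** The inner B is evaluated by Heine's identity with a = d1 d2 / q and b = d3 d4; the required
    phi(abL) is the second numerator of the middle factor, while phi(L) goes into the weight. *)
Lemma opT_serS d1 d2 d3 d4 i :
  leftF * gauss q i (middleF d1 d2 d3 d4 * gauss q i (rightF d1 d2 d3 d4)) =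
  opT i (serS d1 d2 d3 d4 i).
Proof.
rewrite /opT; congr (_ * gauss _ _ _).
have E := gauss_heine q0 q1 i (q^-1 * d1 * d2) (d3 * d4).
rewrite -mulrA gauss_diag in E; last by move=> a b /negPf /= ->.
rewrite [q^-1 * d1 * d2 * (d3 * d4)]mulrA -/(rightF d1 d2 d3 d4) in E.
rewrite /middleF /weightF /serS !rmorphM.
transitivity (in_L (qb 1 0) *
  ((in_x (qb 0 (- d1)) * in_x (qb 0 (- d2))) * (in_y (qb 0 (- d3)) * in_y (qb 0 (-
    d4)))) *
  (in_L (qb (q^-1 * d1 * d2 * d3 * d4) 0) * gauss q i (rightF d1 d2 d3 d4))).
  by ring.
rewrite E.
have -> : q ^ (i + 1) * (q^-1 * d1 * d2) = q ^ i * d1 * d2.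
  by rewrite expfzDr // expr1z; field.
rewrite !mulrA -(qM (- (q ^ i * d1 * d2)) 0 (- d1)) -(qM (- (q ^ (- i) * d3 * d4)) 0
  (- d3)).
rewrite -(qM 0 (-1) (- d2)) -(qM 0 (-1) (- d4)) !rmorphM.
by ring.
Qed.

End Operators.

(** * Translation of the operator into series in x and L/x *)

Section Encoding.
Variable K : numFieldType.
Local Notation S1 := (fps K).
Local Notation S2 := (fps (fps K)).
Local Open Scope classical_set_scope.

(* x^i f, written in the monomials x^j L^k *)
Definition emb (i : int) (f : nat -> nat -> K) : int -> nat -> K :=
  fun j k => if j - i + k%:Z is Posz n then f n k else 0.

Definition fps2 (f : nat -> nat -> K) : S2 := Fps (fun a => Fps (f a)).

Lemma fps2M f g : fps2 (ps2_mul f g) = fps2 f * fps2 g.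
Proof. by apply: fps2P => a b; rewrite coefs2M. Qed.

Lemma mulop_emb g i f : mulop g (emb i f) = emb i (ps2_mul g f).
Proof.
apply/funext => j; apply/funext => k; rewrite /mulop /emb.
case E : (j - i + k%:Z) => [n|n]; last first.
  apply: fsbig1 => -[a b] /= hb.
  have -> : j - a%:Z + b%:Z - i + (k - b)%N%:Z = Negz (n + a) by lia.
  by rewrite mulr0.
(* Terms with a > n vanish: they ask for the coefficient of x^(n - a) in f, a negative power. *)
pose s := [seq (a, b) | a <- iota 0 n.+1, b <- iota 0 k.+1].
have us : uniq s.
  by apply: allpairs_uniq => [||[? ?] [? ?] _ _ /= []]; rewrite ?iota_uniq // => -> ->.
rewrite -(@fsbig_widen _ _ _ _ [set` s]); last 2 first.
- by move=> [a b] /allpairsP[[a' b'] [_ hb [_ ->]]]; move: hb; rewrite mem_iota.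
- move=> [a b] /= [hb /negP ns].
  have na : (n < a)%N.
    rewrite ltnNge; apply: contra ns => an; apply/allpairsP; exists (a, b).
    by rewrite !mem_iota /=; split=> //; lia.
  have -> : j - a%:Z + b%:Z - i + (k - b)%N%:Z = Negz (a - n).-1 by lia.
  by rewrite mulr0.
rewrite -fsbig_seq // big_allpairs /ps2_mul -[iota 0 n.+1]/(index_iota 0 n.+1)
  big_mkord.
apply: eq_bigr => a _; rewrite -[iota 0 k.+1]/(index_iota 0 k.+1) big_mkord.
apply: eq_bigr => b _ /=.
have -> : j - (a : nat)%:Z + (b : nat)%:Z - i + (k - b)%N%:Z = Posz (n - a).
  by have := ltn_ord a; have := ltn_ord b; lia.
by [].
Qed.

Lemma Bop_emb q i f : Bop q (emb i f) = emb i (fun a b => gauss q i (fps2 f) a b).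
Proof.
apply/funext => j; apply/funext => k; rewrite /Bop /emb.
case E : (j - i + k%:Z) => [n|n]; last by rewrite mulr0.
by rewrite gaussE; congr (_ ^ tri _ * _); lia.
Qed.

Lemma xpow_emb i : xpow K i = emb i (fun a b => (1 : S2) a b).
Proof.
apply/funext => j; apply/funext => k; rewrite /xpow /emb.
case E : (j - i + k%:Z) => [n|n].
  case: k E => [|k] E; last by case: n E => [|n] E; rewrite andbF.
  case: n E => [|n] E; rewrite coefs1.
    by have -> : (j == i) = true by lia.
  by have -> : (j == i) = false by lia.
case: eqP => //= ji; case: eqP => //= k0; lia.
Qed.

Section GivenQ.
Variable q : K.
Hypothesis q0 : q != 0.
Hypothesis q1 : forall n, q ^+ n.+1 != 1.
Local Notation qb := (qbin q (qinv q)).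
(** Euler's expansion of phi, assumed here to keep this part algebraic; it is established for |q| <
    1 below. *)
Hypothesis phiE : forall n, phi q n = qb 1 0 n.

Lemma qb_scale c d e n : qb c d n * e ^+ n = qb (c * e) (d * e) n.
Proof.
rewrite /=; elim: n => [|n IH]; first by rewrite !big_ord0 mulr1.
by rewrite !big_ord_recr /= -IH exprSr; move: (\prod_(i < n) _) => p; ring.
Qed.

Lemma ps_expE (f : nat -> K) k n : ps_exp f k n = (Fps f ^+ k) n.
Proof.
elim: k n => [|k IH] n; first by [].
by rewrite exprS coefsM; apply: eq_bigr => i _; rewrite -IH.
Qed.

Lemma fps_exp_order (f : S1) k n : f 0%N = 0 -> (n < k)%N -> (f ^+ k) n = 0.
Proof.
move=> f0; elim: k n => [//|k IH] n nk; rewrite exprS coefsM big1 // => -[[|i] /= hi] _.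
  by rewrite f0 mul0r.
by rewrite IH ?mulr0 //; lia.
Qed.

(** With g = 1 - f, the product of 1 - g and the sum of the g^k for k <= n is 1 - g^(n+1), and
    g^(n+1) has no term of degree n. *)
Lemma ps_invK (f : nat -> K) : f 0%N = 1 -> Fps f * Fps (ps_inv f) = 1.
Proof.
move=> f0; apply: fpsP => n; rewrite coefsM.
pose g : S1 := 1 - Fps f.
have gE k m : ps_exp (fun l => ps_one K l - f l) k m = (g ^+ k) m by rewrite ps_expE.
have g0 : g 0%N = 0 by rewrite coefsD coefsN coefs1 /= f0 subrr.
(* The added powers k > i do not reach degree i, so a single truncation serves all i <= n. *)
have E i : (i <= n)%N -> ps_inv f i = (\sum_(k < n.+1) g ^+ k) i.
  move=> hi; rewrite /ps_inv coefs_sum -(big_mkord xpredT (fun k => (g ^+ k) i)).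
  rewrite [RHS](@big_cat_nat _ _ _ i.+1) //= [X in _ = _ + X]big_nat_cond.
  rewrite [X in _ = _ + X]big1 ?addr0; last by move=> k hk;
    apply: fps_exp_order => //; lia.
  by rewrite big_mkord; apply: eq_bigr => k _; rewrite gE.
transitivity ((Fps f * \sum_(k < n.+1) g ^+ k) n).
  by rewrite coefsM; apply: eq_bigr => i _; congr (_ * _); apply: E; exact: leq_subr.
have -> : Fps f = 1 - g by rewrite /g opprB addrC subrK.
rewrite -[1 - g]opprB mulNr -subrX1 opprB coefsD coefsN [X in _ - X]fps_exp_order //.
by rewrite subr0.
Qed.

Lemma phiVE n : phiV q n = qb 0 1 n.
Proof.
have f0 : phi q 0%N = 1 by rewrite phiE /= big_ord0.
have := ps_invK f0; have -> : Fps (phi q) = qb 1 0 by apply: fpsP.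
move=> E; suff -> : qb 0 1 = Fps (ps_inv (phi q)) by [].
rewrite -[LHS]mulr1 -E mulrA qbinM ?qbin_id ?mul1r //; exact: qinvK.
Qed.

Lemma at_x_phiV c : fps2 (at_x (phiV q) c) = in_x (qb 0 c).
Proof.
apply: fps2P => a b; rewrite in_xE /= /at_x; case: eqP => // _.
by rewrite phiVE qb_scale mul1r mul0r.
Qed.

Lemma at_Lx_phiV c : fps2 (at_Lx (phiV q) c) = in_y (qb 0 c).
Proof.
apply: fps2P => a b; rewrite /= /at_Lx; case: eqP => // _.
by rewrite phiVE qb_scale mul1r mul0r.
Qed.

Lemma at_L_phi c : fps2 (at_L (phi q) c) = in_L (qb c 0).
Proof.
apply: fps2P => a b; rewrite /= /at_L; case: eqP => // _.
by rewrite phiE qb_scale mul1r mul0r.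
Qed.

Lemma fps2K (f : S2) : fps2 (fun a b => f a b) = f.
Proof. exact: fps2P. Qed.

Lemma HS_matrixE d1 d2 d3 d4 i j k :
  HS_matrix q d1 d2 d3 d4 i j k =
  emb i (fun a b => opT q i (serS q d1 d2 d3 d4 i) a b) j k.
Proof.
have H g (f : S2) : mulop g (emb i (fun a b => f a b)) =
    emb i (fun a b => (fps2 g * f) a b).
  rewrite mulop_emb; congr (emb i _); apply/funext => a; apply/funext => b.
  by rewrite -{2}[f]fps2K -fps2M.
rewrite /HS_matrix /HS xpow_emb H mulr1 Bop_emb fps2K H Bop_emb fps2K H.
rewrite -opT_serS //; congr (emb i _ j k); apply/funext => a; apply/funext => b.
rewrite /left_factor /middle_factor /right_factor !fps2M.
by rewrite !at_x_phiV !at_Lx_phiV !at_L_phi.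
Qed.

End GivenQ.
End Encoding.

(** * The q-exponential as a limit *)

Section Phi.
Local Open Scope classical_set_scope.
Variable K : numFieldType.
Variable q : K.
Hypothesis q1 : forall n, q ^+ n.+1 != 1.
Local Notation qb := (qbin q (qinv q)).

Definition polyS (p : {poly K}) : fps K := Fps (fun n => p`_n).

Lemma polySM p r : polyS (p * r) = polyS p * polyS r.
Proof. by apply: fpsP => n; rewrite /= coefM. Qed.

Lemma qbin_shift c d : (1 - fpsC d * fpsX K) * qb c d = qb c (d * q).
Proof.
have vK := qinvK q1.
by rewrite -(qbinM vK c 0 d) mulrCA (qbin0_shift vK) (qbinM vK).
Qed.

(** The finite product is phi(z)/phi(q^N z), so its coefficientwise limit reduces to q^N -> 0. *)
Lemma prod_qbin N : polyS (\prod_(k < N) (1 - q ^+ k *: 'X)) = qb 1 (q ^+ N).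
Proof.
elim: N => [|N IH].
  rewrite big_ord0 expr0 (qbin_id (qinvK q1)).
  by apply: fpsP => n; rewrite /= coef1.
rewrite big_ord_recr /= polySM IH mulrC exprSr -qbin_shift; congr (_ * _).
apply: fpsP => n; rewrite coefsD coefsN coefsCM coefs1 /= coefB coef1 coefZ coefX.
by [].
Qed.

Hypothesis q_small :
  forall e : K, 0 < e -> exists N0, forall N, (N0 <= N)%N -> `|q ^+ N| < e.

Lemma expr_cvg0 : q ^+ N @[N --> \oo] --> (0 : K).
Proof.
apply/cvgrPdist_lt => e /q_small[N0 H]; exists N0 => // N /H.
by rewrite sub0r normrN.
Qed.

Lemma qbin_cvg n : qb 1 (q ^+ N) n @[N --> \oo] --> qb 1 0 n.
Proof.
rewrite /=; elim: n => [|n IH].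
  by under eq_fun do rewrite big_ord0; rewrite big_ord0; exact: cvg_cst.
under eq_fun do rewrite big_ord_recr /=.
rewrite big_ord_recr /=; apply: cvgM; first exact: IH.
apply: cvgM; last exact: cvg_cst.
by apply: cvgB; [exact: expr_cvg0 | exact: cvg_cst].
Qed.

Lemma phiE n : phi q n = qb 1 0 n.
Proof.
rewrite /phi; apply: cvg_lim; first exact: norm_hausdorff.
have -> : (fun N => (\prod_(k < N) (1 - q ^+ k *: 'X))`_n) = (fun N => qb 1 (q ^+ N) n).
  by apply/funext => N; rewrite -prod_qbin.
exact: qbin_cvg.
Qed.

End Phi.


Local Open Scope complex_scope.

(** * Powers of a complex q with |q| < 1 *)

Section ComplexPowers.
Local Open Scope classical_set_scope.
Variable R : realType.

Lemma norm_cabs (z : R[i]) : `|z| = (ComplexField.Normc.normc z)%:C.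
Proof. by case: z. Qed.

Lemma expr_small (q : R[i]) : `|q| < 1 ->
  forall e : R[i], 0 < e -> exists N0, forall N, (N0 <= N)%N -> `|q ^+ N| < e.
Proof.
rewrite norm_cabs ltcR; set r := ComplexField.Normc.normc q => r1 [e ei].
(* A positive element of [R[i]] is real, so the claim reduces to real powers. *)
rewrite ltcE /= => /andP[/eqP -> e0].
have r0 : 0 <= r by have := normr_ge0 q; rewrite norm_cabs lecE /= eqxx.
have /cvgrPdist_lt /(_ e e0)[N0 _ H] : r ^+ n @[n --> \oo] --> 0.
  by apply: cvg_expr; rewrite ger0_norm.
exists N0 => N /H /=; rewrite sub0r normrN ger0_norm ?exprn_ge0 // => rN.
by rewrite normrX norm_cabs -rmorphXn /= ltcR.
Qed.

Lemma expr_neq1 (q : R[i]) : `|q| < 1 -> forall n, q ^+ n.+1 != 1.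
Proof.
move=> q1 n; apply/eqP => /(congr1 Num.norm); rewrite normrX normr1 => E.
by have := exprn_ilt1 n.+1 (normr_ge0 q) q1; rewrite E ltxx.
Qed.

End ComplexPowers.

(** * Taylor estimates *)

Section RealTaylor.
Variable R : realType.

(** By the mean value theorem f x = df c * x for some c between 0 and x. The same constant C
    survives, so the step can be iterated. *)
Lemma taylor_step (f df : R -> R) (C : R) (n : nat) :
  (forall x, is_derive x (1 : R) f (df x)) -> f 0 = 0 ->
  (forall x, `|x| <= 1 -> `|df x| <= C * `|x| ^+ n) ->
  forall x, `|x| <= 1 -> `|f x| <= C * `|x| ^+ n.+1.
Proof.
move=> fdf f0 dfC x x1.
have cf (a b : R) : {within `[a, b], continuous f}%classic.
  by apply: derivable_within_continuous => y _; have [] := fdf y.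
have [c cx ->] : exists2 c, `|c| <= `|x| & f x = df c * x.
  have [x0|x0] := leP 0 x.
    have [c + E] := MVT_segment x0 (fun y _ => fdf y) (cf _ _).
    rewrite in_itv /= => /andP[c0 cx]; exists c; first by rewrite !ger0_norm.
    by move: E; rewrite f0 !subr0.
  have [c + E] := MVT_segment (ltW x0) (fun y _ => fdf y) (cf _ _).
  rewrite in_itv /= => /andP[c0 cx]; exists c; last by move: E; rewrite f0; lra.
  by rewrite !ler0_norm ?lerN2 // ltW.
rewrite normrM exprSr mulrA ler_wpM2r //.
apply: le_trans (dfC c (le_trans cx x1)) _.
have C0 : 0 <= C.
  by have := dfC 1; rewrite normr1 expr1n mulr1 => /(_ (lexx _)); apply: le_trans.
by rewrite ler_wpM2l // lerXn2r ?nnegrE.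
Qed.

Lemma sin_taylor1 (y : R) : `|y| <= 1 -> `|sin y| <= `|y|.
Proof.
move=> y1; have := @taylor_step sin cos 1 0 _ _ _ y y1; rewrite mul1r expr1; apply.
- exact: sin0.
by move=> x _; rewrite expr0 mulr1 ler_norml cos_geN1 cos_le1.
Qed.

Lemma cos_taylor1 (y : R) : `|y| <= 1 -> `|cos y - 1| <= `|y| ^+ 2.
Proof.
move=> y1; have := @taylor_step (fun y => cos y - 1) (fun y => - sin y) 1 1 _ _ _ y y1.
rewrite mul1r; apply.
- by move=> x; apply: is_derive_eq; rewrite subr0.
- by rewrite cos0 subrr.
by move=> x x1; rewrite normrN mul1r; apply: sin_taylor1.
Qed.

Lemma sin_taylor3 (y : R) : `|y| <= 1 -> `|sin y - y| <= `|y| ^+ 3.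
Proof.
move=> y1; have := @taylor_step (fun y => sin y - y) (fun y => cos y - 1) 1 2 _ _ _ y
  y1.
rewrite mul1r; apply.
- by rewrite sin0 subrr.
by move=> x x1; rewrite mul1r; apply: cos_taylor1.
Qed.

Lemma cos_taylor3 (y : R) : `|y| <= 1 -> `|cos y - 1 + y ^+ 2 / 2| <= `|y| ^+ 3.
Proof.
move=> y1; apply: (@le_trans _ _ (`|y| ^+ 4)); last first.
  by rewrite [leLHS]exprSr ler_piMr ?exprn_ge0.
have := @taylor_step (fun y => cos y - 1 + y ^+ 2 / 2) (fun y => - (sin y - y)) 1 3 _
  _ _ y y1.
rewrite mul1r; apply.
- by move=> x; apply: is_derive_eq; rewrite /GRing.scale /=; lra.
- by rewrite cos0 expr2 !mul0r addr0 subrr.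
by move=> x x1; rewrite normrN mul1r; apply: sin_taylor3.
Qed.

(** Three integrations from 0, starting from the bound exp x <= e on [-1, 1]. *)
Lemma expR_taylor3 (x : R) : `|x| <= 1 ->
  `|expR x - 1 - x - x ^+ 2 / 2| <= expR 1 * `|x| ^+ 3.
Proof.
apply: (@taylor_step (fun x => expR x - 1 - x - x ^+ 2 / 2) (fun x => expR x - 1 -
  x)) => [{}x||{}x].
- by apply: is_derive_eq; rewrite /GRing.scale /=; lra.
- by rewrite expR0 expr2 !mul0r !subr0 subrr.
apply: (@taylor_step (fun x => expR x - 1 - x) (fun x => expR x - 1)) => [{}x||{}x].
- by apply: is_derive_eq; rewrite /GRing.scale /=; lra.
- by rewrite expR0 !subr0 subrr.
apply: (@taylor_step (fun x => expR x - 1) expR) => [{}x||{}x].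
- by apply: is_derive_eq; rewrite /GRing.scale /=; lra.
- by rewrite expR0 subrr.
by move=> x1; rewrite expr0 mulr1 ger0_norm ?expR_ge0 // ler_expR; case/ler_normlP: x1.
Qed.

End RealTaylor.

(** * The complex exponential and the calculus of expansions at h = 0 *)

Section Expansions.
Variable R : realType.
Local Notation C := R[i].
(** The modulus as a real number, whereas the norm of [R[i]] takes values in [R[i]]. *)
Definition cabs (z : C) : R := ComplexField.Normc.normc z.
Implicit Types (f g : C -> C) (a b h z : C).

Lemma cabs_ge0 z : 0 <= cabs z.
Proof. by have := normr_ge0 z; rewrite norm_cabs lecE /= eqxx. Qed.

Lemma cabsM z w : cabs (z * w) = cabs z * cabs w.
Proof. exact: ComplexField.Normc.normcM. Qed.

Lemma cabs1 : cabs 1 = 1.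
Proof. exact: ComplexField.Normc.normc1. Qed.

Lemma cabsX z n : cabs (z ^+ n) = cabs z ^+ n.
Proof. by elim: n => [|n IH]; rewrite ?expr0 ?cabs1 // !exprS cabsM IH. Qed.

Lemma cabsN z : cabs (- z) = cabs z.
Proof. by case: z => x y; rewrite /cabs /= !sqrrN. Qed.

Lemma cabsD z w : cabs (z + w) <= cabs z + cabs w.
Proof. exact: le_normcD. Qed.

Lemma cabsV z : cabs z^-1 = (cabs z)^-1.
Proof. exact: ComplexField.Normc.normcV. Qed.

Lemma cabs_gt0 z : z != 0 -> 0 < cabs z.
Proof.
move=> z0; rewrite lt_neqAle cabs_ge0 andbT eq_sym; apply: contra z0 => /eqP.
by move/ComplexField.Normc.eq0_normc ->.
Qed.

Lemma cabs_le_add (x y : R) : cabs (Complex x y) <= `|x| + `|y|.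
Proof.
rewrite /cabs /= -[leRHS]ger0_norm ?addr_ge0 // -sqrtr_sqr ler_sqrt ?sqr_ge0 //.
rewrite -(real_normK (num_real x)) -(real_normK (num_real y)).
by have := mulr_ge0 (normr_ge0 x) (normr_ge0 y); nra.
Qed.

Lemma abs_Re_le z : `|complex.Re z| <= cabs z.
Proof.
by case: z => x y; rewrite /cabs /= -sqrtr_sqr ler_sqrt ?addr_ge0 ?sqr_ge0 // lerDl
  sqr_ge0.
Qed.

Lemma abs_Im_le z : `|complex.Im z| <= cabs z.
Proof.
by case: z => x y; rewrite /cabs /= -sqrtr_sqr ler_sqrt ?addr_ge0 ?sqr_ge0 // lerDr
  sqr_ge0.
Qed.

Lemma expC0 : expC (0 : C) = 1.
Proof. by rewrite /expC /= expR0 cos0 sin0 !mul1r. Qed.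

Lemma expCD z w : expC (z + w) = expC z * expC w.
Proof.
case: z w => [x y] [x' y']; rewrite /expC /= expRD cosD sinD.
by apply/eqP; rewrite eq_complex /=; apply/andP; split; apply/eqP; ring.
Qed.

Lemma expC_neq0 z : expC z != 0.
Proof.
apply/eqP => z0; have := expCD z (- z); rewrite z0 mul0r subrr expC0.
by move/eqP; rewrite oner_eq0.
Qed.

Lemma expCN z : expC (- z) = (expC z)^-1.
Proof.
apply: (mulIf (expC_neq0 z)); rewrite mulVf ?expC_neq0 //.
by rewrite -expCD addNr expC0.
Qed.

Lemma expC_nat z n : expC (z * n%:R) = expC z ^+ n.
Proof.
elim: n => [|n IH]; first by rewrite mulr0 expC0.
by rewrite -addn1 natrD mulrDr mulr1 expCD IH addn1 exprSr.
Qed.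

Lemma expC_int z (i : int) : expC (z * i%:~R) = expC z ^ i.
Proof.
case: i => n; first by rewrite -exprnP -expC_nat.
by rewrite NegzE rmorphN /= mulrN expCN -exprnN -expC_nat.
Qed.

Lemma expC_taylor : exists2 M : R, 0 <= M & forall z, cabs z <= 1 ->
  cabs (expC z - 1 - z - z ^+ 2 / 2) <= M * cabs z ^+ 3.
Proof.
(* The real and the imaginary part are each at most (e + 4) t^3, with t = |z|: e comes from [r1],
   5/2 from [r2] or [r3], and at most 3/4 from the remaining monomials. *)
exists (2 * (expR 1 + 4)); first by rewrite mulr_ge0 // addr_ge0 ?expR_ge0.
move=> z z1; have := abs_Re_le z; have := abs_Im_le z.
case: z z1 => x y z1; set t := cabs _ in z1 *;
  rewrite [complex.Re _]/= [complex.Im _]/=.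
move=> yt xt.
have E3 := expR_taylor3 (le_trans xt z1).
have c3 := cos_taylor3 (le_trans yt z1).
have s3 := sin_taylor3 (le_trans yt z1).
set r1 := expR x - 1 - x - x ^+ 2 / 2 in E3.
set r2 := cos y - 1 + y ^+ 2 / 2 in c3.
set r3 := sin y - y in s3.
have -> : expC (Complex x y) - 1 - Complex x y - Complex x y ^+ 2 / 2 =
  Complex (r1 * cos y + (1 + x + x ^+ 2 / 2) * r2 - y ^+ 2 * x / 2 - y ^+ 2 * x ^+ 2
    / 4)
          (r1 * sin y + (1 + x + x ^+ 2 / 2) * r3 + x ^+ 2 * y / 2).
  have -> : (2 : C)^-1 = (2^-1 : R)%:C by rewrite fmorphV rmorph_nat.
  apply/eqP; rewrite eq_complex /= /r1 /r2 /r3.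
  by apply/andP; split; apply/eqP; field.
have t0 : 0 <= t := cabs_ge0 _.
have e0 := expR_ge0 (1 : R).
have t3 : 0 <= t ^+ 3 by apply: exprn_ge0.
have cube (u : R) : `|u| <= t -> `|u| ^+ 3 <= t ^+ 3 by move=> ut;
  rewrite lerXn2r ?nnegrE.
have R1 : `|r1| <= expR 1 * t ^+ 3 by apply: le_trans E3 _; rewrite ler_wpM2l // cube.
have R2 : `|r2| <= t ^+ 3 by apply: le_trans c3 (cube _ yt).
have R3 : `|r3| <= t ^+ 3 by apply: le_trans s3 (cube _ yt).
have c1 : `|cos y| <= 1 by rewrite ler_norml cos_geN1 cos_le1.
have s1 : `|sin y| <= 1 by rewrite ler_norml sin_geN1 sin_le1.
have P : `|1 + x + x ^+ 2 / 2| <= 5 / 2.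
  by rewrite ler_norml; case/ler_normlP: (le_trans xt z1) => ? ?; apply/andP; split;
    nra.
have mul_le (u v U V : R) : `|u| <= U -> `|v| <= V -> `|u * v| <= U * V.
  by move=> ? ?; rewrite normrM ler_pM.
have Y2 : `|y ^+ 2| <= t ^+ 2 by rewrite normrX lerXn2r ?nnegrE.
have X2 : `|x ^+ 2| <= t ^+ 2 by rewrite normrX lerXn2r ?nnegrE.
have A1 := mul_le _ _ _ _ R1 c1.
have A2 := mul_le _ _ _ _ P R2.
have A3 := mul_le _ _ _ _ Y2 xt.
have A4 := mul_le _ _ _ _ Y2 X2.
have B1 := mul_le _ _ _ _ R1 s1.
have B2 := mul_le _ _ _ _ P R3.
have B3 := mul_le _ _ _ _ X2 yt.
have T4 : t ^+ 2 * t ^+ 2 <= t ^+ 3.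
  by rewrite -exprD [leLHS]exprSr ler_piMr.
have T3 : t ^+ 2 * t = t ^+ 3 by rewrite -exprSr.
rewrite T3 in A3 B3.
apply: le_trans (cabs_le_add _ _) _.
move/ler_normlP: A1 => [? ?]; move/ler_normlP: A2 => [? ?].
move/ler_normlP: A3 => [? ?]; move/ler_normlP: A4 => [? ?].
move/ler_normlP: B1 => [? ?]; move/ler_normlP: B2 => [? ?].
move/ler_normlP: B3 => [? ?].
have LA : `|r1 * cos y + (1 + x + x ^+ 2 / 2) * r2 - y ^+ 2 * x / 2 - y ^+ 2 * x ^+ 2
  / 4|
   <= (expR 1 + 4) * t ^+ 3.
  by apply/ler_normlP; split; lra.
have LB : `|r1 * sin y + (1 + x + x ^+ 2 / 2) * r3 + x ^+ 2 * y / 2|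
   <= (expR 1 + 4) * t ^+ 3.
  by apply/ler_normlP; split; lra.
lra.
Qed.

(** This is |q| < 1, where phi converges. The point h = 0 lies outside, so division by h is
    legitimate. *)
Definition admissible h := cabs (expC h) < 1.

Lemma admissible_neq0 h : admissible h -> h != 0.
Proof. by rewrite /admissible; apply: contraTneq => ->; rewrite expC0 cabs1 ltxx. Qed.

Definition near_bounded f := exists M d : R,
  [/\ 0 <= M, 0 < d & forall h, admissible h -> cabs h < d -> cabs (f h) <= M].

Lemma near_bounded_ext f g : (forall h, admissible h -> f h = g h) ->
  near_bounded f -> near_bounded g.
Proof.
move=> fg [M [d [M0 d0 H]]]; exists M, d; split=> // h ah hd.
by rewrite -fg //; apply: H.
Qed.

Lemma near_bounded_cst a : near_bounded (fun=> a).
Proof. by exists (cabs a), 1; split=> //; exact: cabs_ge0. Qed.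

Lemma near_bounded_id : near_bounded (fun h => h).
Proof. by exists 1, 1; split=> // h _ /ltW. Qed.

Lemma near_boundedD f g : near_bounded f -> near_bounded g ->
  near_bounded (fun h => f h + g h).
Proof.
move=> [M [d [M0 d0 H]]] [M' [d' [M0' d0' H']]].
exists (M + M'), (Num.min d d'); split; [lra|by rewrite lt_min d0|].
move=> h ah; rewrite lt_min => /andP[hd hd'].
by apply: le_trans (cabsD _ _) _; apply: lerD; [apply: H|apply: H'].
Qed.

Lemma near_boundedM f g : near_bounded f -> near_bounded g ->
  near_bounded (fun h => f h * g h).
Proof.
move=> [M [d [M0 d0 H]]] [M' [d' [M0' d0' H']]].
exists (M * M'), (Num.min d d'); split; [exact: mulr_ge0|by rewrite lt_min d0|].
move=> h ah; rewrite lt_min => /andP[hd hd'].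
by rewrite cabsM ler_pM ?cabs_ge0 //; [apply: H|apply: H'].
Qed.

(** An explicit bounded factor r in place of O(h^2) makes the calculus of expansions a matter of
    polynomial identities. *)
Definition expands f a b :=
  exists2 r, near_bounded r & forall h, admissible h -> f h = a + h * b + h ^+ 2 * r h.

Lemma expands_ext f g a b : (forall h, admissible h -> f h = g h) ->
  expands f a b -> expands g a b.
Proof. by move=> fg [r Br E]; exists r => // h ah; rewrite -fg // E. Qed.

Lemma expands_eq f a b a' b' : expands f a b -> a = a' -> b = b' -> expands f a' b'.
Proof. by move=> ? <- <-. Qed.

Lemma expands_cst a : expands (fun=> a) a 0.
Proof. by exists (fun=> 0) => [|h _]; [exact: near_bounded_cst | ring]. Qed.

Lemma expands_id : expands (fun h => h) 0 1.
Proof. by exists (fun=> 0) => [|h _]; [exact: near_bounded_cst | ring]. Qed.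

Lemma expandsD f g a b a' b' : expands f a b -> expands g a' b' ->
  expands (fun h => f h + g h) (a + a') (b + b').
Proof.
move=> [r Br E] [r' Br' E']; exists (fun h => r h + r' h); first exact: near_boundedD.
by move=> h ah; rewrite E // E' //; ring.
Qed.

Lemma expandsM f g a b a' b' : expands f a b -> expands g a' b' ->
  expands (fun h => f h * g h) (a * a') (a * b' + b * a').
Proof.
move=> [r Br E] [r' Br' E'].
exists (fun h => b * b' + (a * r' h + a' * r h) + h * (b * r' h + b' * r h)
                 + h * h * (r h * r' h)).
  by do ![apply: near_bounded_cst | apply: near_bounded_id | apply: near_boundedD |
    apply: near_boundedM | done].
by move=> h ah; rewrite E // E' //; ring.
Qed.

Lemma expands_bounded f a b : expands f a b -> near_bounded f.
Proof.
move=> [r Br E]; apply: (@near_bounded_ext (fun h => a + h * b + h * h * r h)).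
  by move=> h ah; rewrite E.
by do ![apply: near_bounded_cst | apply: near_bounded_id | apply: near_boundedD |
  apply: near_boundedM | done].
Qed.

Lemma expands_boundedV f a b : a != 0 -> expands f a b ->
  near_bounded (fun h => (f h)^-1).
Proof.
move=> a0 [r Br E].
have [M [d [M0 d0 H]]] : near_bounded (fun h => b + h * r h).
  by do ![apply: near_bounded_cst | apply: near_bounded_id | apply: near_boundedD |
    apply: near_boundedM | done].
have na0 := cabs_gt0 a0.
(* In this radius |h| M < |a| / 2, hence |f h| >= |a| / 2; M + 1 avoids dividing by zero. *)
exists (2 / cabs a), (Num.min d (cabs a / (2 * (M + 1)))); split.
- by rewrite divr_ge0 // ltW.
- by rewrite lt_min d0 /= divr_gt0 // mulr_gt0 //; lra.
move=> h ah; rewrite lt_min => /andP[hd]; rewrite ltr_pdivlMr; last lra.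
move=> hM; rewrite cabsV -[2 / cabs a]invf_div lef_pV2 ?posrE ?divr_gt0 //; last first.
  rewrite cabs_gt0 //; apply: contraTneq hM => f0; rewrite -leNgt.
  have -> : cabs a = cabs h * cabs (b + h * r h).
    rewrite -cabsM -cabsN; congr cabs; apply/eqP; rewrite -subr_eq0 -oppr_eq0;
      apply/eqP.
    by rewrite -f0 E //; ring.
  by have := H _ ah hd; have := cabs_ge0 h; nra.
have : cabs a <= cabs (f h) + cabs h * cabs (b + h * r h).
  have := cabsD (f h) (- (h * (b + h * r h))); rewrite cabsN cabsM.
  by have -> : f h + - (h * (b + h * r h)) = a by rewrite E //; ring.
by have := H _ ah hd; have := cabs_ge0 h; nra.
Qed.

Lemma expandsV f a b : a != 0 -> (forall h, admissible h -> f h != 0) ->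
  expands f a b ->
  expands (fun h => (f h)^-1) a^-1 (- b / a ^+ 2).
Proof.
move=> a0 f0 xf; have [r Br E] := xf; have BV := expands_boundedV a0 xf.
(* The remainder of 1/f, solved for; it is bounded because r and 1/f are. *)
exists (fun h => (b * b + (- a) * r h + h * (b * r h)) * (a ^- 2 * (f h)^-1)).
  by do ![apply: BV | apply: near_bounded_cst | apply: near_bounded_id | apply:
    near_boundedD | apply: near_boundedM | done].
move=> h ah; have fh := f0 h ah; rewrite E // in fh *; field.
by rewrite a0 fh.
Qed.

(** Dividing by h costs one order, hence the cubic Taylor remainder. These quotients are the
    building blocks of the coefficients of phi(cz)/phi(dz). *)
Lemma expands_expC_sub1 (c : C) : expands (fun h => (expC (h * c) - 1) / h) c (c ^+ 2
  / 2).
Proof.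
have [M M0 HM] := expC_taylor.
exists (fun h => (expC (h * c) - 1 - h * c - (h * c) ^+ 2 / 2) / h ^+ 3); last first.
  move=> h /admissible_neq0 h0; field; exact: h0.
exists (M * cabs c ^+ 3), (cabs c + 1)^-1; have c0 := cabs_ge0 c; split.
- by rewrite mulr_ge0 // exprn_ge0.
- by rewrite invr_gt0; lra.
move=> h ah hd; have h0 := cabs_gt0 (admissible_neq0 ah).
have hc : cabs (h * c) <= 1.
  by rewrite -[(_ + _)^-1]mul1r ltr_pdivlMr in hd; [rewrite cabsM; nra | lra].
rewrite cabsM cabsV cabsX ler_pdivrMr ?exprn_gt0 //.
apply: le_trans (HM _ hc) _; rewrite cabsM exprMn [leLHS]mulrCA [leRHS]mulrC.
by [].
Qed.

Lemma expands_expC (c : C) : expands (fun h => expC (h * c)) 1 c.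
Proof.
have := expandsD (expands_cst 1) (expandsM expands_id (expands_expC_sub1 c)).
rewrite !(mul0r, mul1r, add0r, addr0); apply: expands_ext => h /admissible_neq0 h0.
by field.
Qed.

End Expansions.

(** * First-order expansions in h *)

Section Binomial.
Variable K : numFieldType.
Local Notation S1 := (fps K).

(* (1 - s z)^(-a) *)
Definition binom_fps (s a : K) : S1 :=
  Fps (fun n => \prod_(k < n) (s * (a + k%:R) / k.+1%:R)).

(** The Euler derivation z d/dz. *)
Definition theta (f : S1) : S1 := Fps (fun n => n%:R * f n).

Lemma thetaE f n : theta f n = n%:R * f n. Proof. by []. Qed.

Lemma thetaM f g : theta (f * g) = theta f * g + f * theta g.
Proof.
apply: fpsP => n; rewrite coefsD thetaE !coefsM mulr_sumr -big_split /=.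
apply: eq_bigr => i _.
have -> : n%:R = i%:R + (n - i)%:R :> K.
  by rewrite -natrD subnKC // -ltnS.
by ring.
Qed.

Local Notation bb := (binom_fps (-1)).

Lemma binom_fpsS s a n : n.+1%:R * binom_fps s a n.+1 = s * (a + n%:R) * binom_fps s
  a n.
Proof.
rewrite /= big_ord_recr /=; have : n.+1%:R != 0 :> K by rewrite pnatr_eq0.
by move: n.+1%:R (\prod_(k < n) _) => d p d0; field.
Qed.

Lemma binom_fps_ode a : (1 + fpsX K) * theta (bb a) = - (fpsC a * fpsX K * bb a).
Proof.
apply: fpsP => -[|n]; rewrite mulrDl mul1r coefsD coefsN -mulrA coefsCM !coefsXM
  !thetaE.
  by rewrite !mul0r mulr0 oppr0 addr0.
by rewrite binom_fpsS; ring.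
Qed.

(** The differential equation of (1 + z)^(-a) fixes f_(n+1) from f_n because n + 1 is invertible. *)
Lemma binom_fps_uniq a (f : S1) : f 0%N = 1 ->
  (1 + fpsX K) * theta f = - (fpsC a * fpsX K * f) -> f = bb a.
Proof.
move=> f0 E; apply: fpsP; elim=> [|n IH]; first by rewrite f0 /= big_ord0.
have : ((1 + fpsX K) * theta f) n.+1 = (- (fpsC a * fpsX K * f)) n.+1 by rewrite E.
rewrite mulrDl mul1r coefsD coefsN -mulrA coefsCM !coefsXM !thetaE => En.
apply: (mulfI (_ : n.+1%:R != 0)); first by rewrite pnatr_eq0.
rewrite binom_fpsS -IH; apply: subr0_eq; move/eqP: En; rewrite -subr_eq0 => /eqP <-.
by ring.
Qed.

Lemma binom_fpsM a b : bb a * bb b = bb (a + b).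
Proof.
apply: binom_fps_uniq; first by rewrite coefsM big_ord1 /= !big_ord0 mulr1.
rewrite thetaM; have Ea := binom_fps_ode a; have Eb := binom_fps_ode b.
transitivity ((1 + fpsX K) * theta (bb a) * bb b + bb a * ((1 + fpsX K) * theta (bb
  b))).
  by ring.
by rewrite Ea Eb rmorphD; ring.
Qed.

Lemma binom_fps0 : bb 0 = 1.
Proof.
apply/esym/binom_fps_uniq => //; rewrite rmorph0 !mul0r oppr0.
have -> : theta 1 = 0 by apply: fpsP => -[|n]; rewrite thetaE coefs1 ?mul0r ?mulr0.
by rewrite mulr0.
Qed.

Lemma binom_fpsN1 : bb (-1) = 1 + fpsX K.
Proof.
apply/esym/binom_fps_uniq; first by rewrite coefsD coefs1 /= addr0.
have -> : theta (1 + fpsX K) = fpsX K.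
  apply: fpsP => -[|[|n]]; rewrite thetaE coefsD coefs1 /= ?mul0r ?addr0 ?add0r
    ?mulr1 ?mulr0 //.
by rewrite rmorphN rmorph1; ring.
Qed.

Lemma binom_fps1K : (1 + fpsX K) * bb 1 = 1.
Proof. by rewrite -binom_fpsN1 binom_fpsM addNr binom_fps0. Qed.

Lemma theta_binom_fps a : theta (bb a) = - (fpsC a * fpsX K * bb 1) * bb a.
Proof.
rewrite -[LHS]mul1r -binom_fps1K mulrAC binom_fps_ode; ring.
Qed.

End Binomial.

(** * Passing expansions through sums and products of series *)

Section ExpansionCalculus.
Variables (T : Type) (K : fieldType) (E : (T -> K) -> K -> K -> Prop).
Hypothesis E_cst : forall a, E (fun=> a) a 0.
Hypothesis E_add : forall f g a b a' b', E f a b -> E g a' b' ->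
  E (fun h => f h + g h) (a + a') (b + b').
Hypothesis E_mul : forall f g a b a' b', E f a b -> E g a' b' ->
  E (fun h => f h * g h) (a * a') (a * b' + b * a').

Lemma expand_sum (n : nat) (F : T -> nat -> K) (a b : nat -> K) :
  (forall i, E (fun h => F h i) (a i) (b i)) ->
  E (fun h => \sum_(i < n) F h i) (\sum_(i < n) a i) (\sum_(i < n) b i).
Proof.
move=> H; elim: n => [|n IH].
  rewrite !big_ord0; have -> : (fun h => \sum_(i < 0) F h i) = fun=> 0.
    by apply/funext => h; rewrite big_ord0.
  exact: E_cst.
rewrite !big_ord_recr /=.
have -> : (fun h => \sum_(i < n.+1) F h i) = fun h => \sum_(i < n) F h i + F h n.
  by apply/funext => h; rewrite big_ord_recr.
exact: E_add.
Qed.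

Lemma expand_fpsM (F G : T -> fps (fps K)) (f f' g g' : fps (fps K)) :
  (forall a b, E (fun h => F h a b) (f a b) (f' a b)) ->
  (forall a b, E (fun h => G h a b) (g a b) (g' a b)) ->
  forall a b, E (fun h => (F h * G h) a b) ((f * g) a b) ((f * g' + f' * g) a b).
Proof.
move=> HF HG a b.
have -> : (fun h => (F h * G h) a b) = (fun h => \sum_(i < a.+1) \sum_(j < b.+1)
   F h i j * G h (a - i)%N (b - j)%N) by apply/funext => h; rewrite coefs2M.
rewrite coefs2D !coefs2M -big_split /=.
apply: (@expand_sum _ (fun h i => \sum_(j < b.+1) F h i j * G h (a - i)%N (b - j)%N)
  (fun i => \sum_(j < b.+1) f i j * g (a - i)%N (b - j)%N)
  (fun i => \sum_(j < b.+1) f i j * g' (a - i)%N (b - j)%N +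
   \sum_(j < b.+1) f' i j * g (a - i)%N (b - j)%N)) => i.
rewrite -big_split /=.
apply: (@expand_sum _ (fun h j => F h i j * G h (a - i)%N (b - j)%N)
  (fun j => f i j * g (a - i)%N (b - j)%N)
  (fun j => f i j * g' (a - i)%N (b - j)%N + f' i j * g (a - i)%N (b - j)%N)) => j.
exact: E_mul.
Qed.

End ExpansionCalculus.

(** * Expansions of families of series indexed by h *)

Section Families.
Variable R : realType.
Local Notation C := R[i].
Local Notation S1 := (fps C).
Local Notation S2 := (fps (fps C)).
Implicit Types (F G : C -> S2) (f g : S2).
Local Notation bb := (binom_fps (-1 : C)).

Definition fps_expands F f f' := forall a b, expands (fun h => F h a b) (f a b) (f' a
  b).

Lemma fps_expands_ext F G f f' : (forall h, admissible h -> F h = G h) ->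
  fps_expands F f f' -> fps_expands G f f'.
Proof. by move=> FG H a b; apply: expands_ext (H a b) => h ah; rewrite FG. Qed.

Lemma fps_expands_cst f : fps_expands (fun=> f) f 0.
Proof. by move=> a b; exact: expands_cst. Qed.

Lemma fps_expandsD F G f f' g g' : fps_expands F f f' -> fps_expands G g g' ->
  fps_expands (fun h => F h + G h) (f + g) (f' + g').
Proof. by move=> HF HG a b; apply: expandsD. Qed.

Lemma fps_expandsM F G f f' g g' : fps_expands F f f' -> fps_expands G g g' ->
  fps_expands (fun h => F h * G h) (f * g) (f * g' + f' * g).
Proof. exact: (expand_fpsM (@expands_cst R) (@expandsD R) (@expandsM R)). Qed.

Lemma fps_expands_in_c (c : C -> C) a b : expands c a b ->
  fps_expands (fun h => in_c (c h)) (in_c a) (in_c b).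
Proof. by move=> H [|m] [|n] //=; exact: expands_cst. Qed.

Lemma fps_expands_in_x (G : C -> S1) (g g' : S1) : (forall n, expands (fun h => G h
  n) (g n) (g' n)) ->
  fps_expands (fun h => in_x (G h)) (in_x g) (in_x g').
Proof. by move=> H m [|n] //=; exact: expands_cst. Qed.

Lemma fps_expands_in_y (G : C -> S1) (g g' : S1) : (forall n, expands (fun h => G h
  n) (g n) (g' n)) ->
  fps_expands (fun h => in_y (G h)) (in_y g) (in_y g').
Proof. by move=> H [|m] n //=; exact: expands_cst. Qed.

(* F = f (1 + h g + O(h^2)) *)
Definition rel_expands F f g := fps_expands F f (f * g).

(** Relative first-order terms add up, as logarithmic derivatives do. *)
Lemma rel_expandsM F G f f' g g' : rel_expands F f g -> rel_expands G f' g' ->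
  rel_expands (fun h => F h * G h) (f * f') (g + g').
Proof.
move=> HF HG; rewrite /rel_expands;
  have -> : f * f' * (g + g') = f * (f' * g') + f * g * f' by ring.
exact: fps_expandsM.
Qed.

Lemma rel_expands_expC c : rel_expands (fun h => in_c (expC (h * c))) 1 (in_c c).
Proof. by rewrite /rel_expands mul1r -(rmorph1 (@in_c C));
  apply/fps_expands_in_c/expands_expC. Qed.

Local Notation qb h := (qbin (expC h) (qinv (expC h))).

Lemma admissible_norm (h : C) : admissible h -> `|expC h| < 1.
Proof. by rewrite /admissible norm_cabs => H; rewrite -[1]/(1%:C) ltcR. Qed.

Lemma admissible_expr_neq1 (h : C) : admissible h -> forall n, expC h ^+ n.+1 != 1.
Proof. by move=> /admissible_norm; exact: expr_neq1. Qed.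

(** With a = c - d, the k-th factor is s q^d (q^(a+k) - 1)/(q^(k+1) - 1), where the poles in h
    cancel. Its relative correction d + (a + k)/2 - (k + 1)/2 does not depend on k, so n factors
    give n times the same amount. *)
Lemma expands_qbin (s c d : C) n :
  expands (fun h => qb h (s * expC (h * c)) (s * expC (h * d)) n)
     (binom_fps s (c - d) n) ((d + (c - d - 1) / 2) * (n%:R * binom_fps s (c - d) n)).
Proof.
elim: n => [|n IH].
  rewrite mul0r mulr0 /= big_ord0; apply: expands_ext (expands_cst 1) => h _.
  by rewrite big_ord0.
set a : C := c - d in IH *.
have n0 : n.+1%:R != 0 :> C by rewrite pnatr_eq0.
have V : expands (fun h : C => ((expC (h * n.+1%:R) - 1) / h)^-1) n.+1%:R^-1
    (- (n.+1%:R ^+ 2 / 2) / n.+1%:R ^+ 2).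
  apply: (expandsV n0 _ (expands_expC_sub1 n.+1%:R)) => h ah.
  apply: mulf_neq0; last by rewrite invr_eq0 admissible_neq0.
  by rewrite subr_eq0 expC_nat admissible_expr_neq1.
have H := expandsM IH (expandsM (expandsM (expands_cst s) (expands_expC d)) (expandsM
  (expands_expC_sub1 (a + n%:R)) V)).
apply: expands_ext (expands_eq H _ _).
- move=> h ah; rewrite [RHS]/= big_ord_recr /=; congr (_ * _).
  have h0 := admissible_neq0 ah; have q1 := admissible_expr_neq1 ah n.
  have -> : expC (h * c) = expC (h * d) * expC (h * a).
    by rewrite -expCD; congr expC; rewrite /a; ring.
  rewrite mulrDr expCD !expC_nat /qinv.
  move: (expC (h * d)) (expC (h * a)) (expC h ^+ n) (expC h ^+ n.+1) q1 => D A N N1 q1.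
  by field; rewrite h0 !subr_eq0 q1 eq_sym q1.
- by rewrite [RHS]/= big_ord_recr /= mulr1 !mulrA.
rewrite [binom_fps s a n.+1]/= big_ord_recr /= -/(binom_fps s a n).
move: (\prod_(k < n) _) n0 => u; rewrite -natr1; move: (n%:R) => N N0.
by field.
Qed.

Lemma expands_qbin_at (s c d : C) (u v : C -> C) n :
  (forall h, u h = s * expC (h * c)) -> (forall h, v h = s * expC (h * d)) ->
  expands (fun h => qb h (u h) (v h) n)
     (binom_fps s (c - d) n) ((d + (c - d - 1) / 2) * (n%:R * binom_fps s (c - d) n)).
Proof. by move=> uE vE; apply: expands_ext (expands_qbin s c d n) => h _;
  rewrite uE vE. Qed.

(** The factor n of [expands_qbin] acts as [theta], and the logarithmic derivative of (1 + z)^(-(c -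
    d)) is -(c - d) z/(1 + z); this is the resulting coefficient of z/(1 + z). *)
Definition qbin_rel_coef (c d : C) := - (c - d) * (d + (c - d - 1) / 2).

Lemma rel_expands_qbin_x (c d : C) (u v : C -> C) :
  (forall h, u h = - expC (h * c)) -> (forall h, v h = - expC (h * d)) ->
  rel_expands (fun h => in_x (qb h (u h) (v h))) (in_x (bb (c - d)))
     (in_c (qbin_rel_coef c d) * (vx C * in_x (bb 1))).
Proof.
move=> uE vE; set k := d + (c - d - 1) / 2.
rewrite /rel_expands; have -> : in_x (bb (c - d)) * (in_c (qbin_rel_coef c d) * (vx C
  * in_x (bb 1))) =
   in_x (fpsC k * theta (bb (c - d))).
  have E (e : C) : in_c e = in_x (fpsC e) by apply: fpsP => -[|n] //;
    rewrite in_xE /= rmorph0.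
  rewrite theta_binom_fps E /vx -!rmorphM; congr in_x; rewrite /qbin_rel_coef -/k;
    move: (c - d) => a.
  by rewrite !(rmorphM, rmorphN); ring.
apply: fps_expands_in_x => n; rewrite coefsCM thetaE.
by apply: expands_qbin_at => h; rewrite mulN1r.
Qed.

Lemma rel_expands_qbin_y (c d : C) (u v : C -> C) :
  (forall h, u h = - expC (h * c)) -> (forall h, v h = - expC (h * d)) ->
  rel_expands (fun h => in_y (qb h (u h) (v h))) (in_y (bb (c - d)))
     (in_c (qbin_rel_coef c d) * (vy C * in_y (bb 1))).
Proof.
move=> uE vE; set k := d + (c - d - 1) / 2.
rewrite /rel_expands; have -> : in_y (bb (c - d)) * (in_c (qbin_rel_coef c d) * (vy C
  * in_y (bb 1))) =
   in_y (fpsC k * theta (bb (c - d))).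
  rewrite theta_binom_fps /vy -[in_c _]/(in_y (fpsC (qbin_rel_coef c d))) -!rmorphM;
    congr in_y.
  rewrite /qbin_rel_coef -/k; move: (c - d) => a.
  by rewrite !(rmorphM, rmorphN); ring.
apply: fps_expands_in_y => n; rewrite coefsCM thetaE.
by apply: expands_qbin_at => h; rewrite mulN1r.
Qed.

Lemma near_bounded_qbin (s c d : C) (u v : C -> C) n :
  (forall h, u h = s * expC (h * c)) -> (forall h, v h = s * expC (h * d)) ->
  near_bounded (fun h => qb h (u h) (v h) n).
Proof. by move=> uE vE; apply: expands_bounded (expands_qbin_at n uE vE). Qed.

Local Notation T h := (opT (expC h)).

Lemma expands0M (u v : C -> C) : expands u 0 0 -> near_bounded v ->
  expands (fun h => u h * v h) 0 0.
Proof.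
move=> [r Br E] Bg; exists (fun h => r h * v h); first exact: near_boundedM.
by move=> h ah; rewrite E //; ring.
Qed.

(** By [opT1] only quotients of two phi occur, and these have bounded coefficients. *)
Lemma near_bounded_opT1 i a b : near_bounded (fun h : C => T h i 1 a b).
Proof.
apply: (@near_bounded_ext _ (fun h : C => expC (h * (tri i)%:~R) *
   (qb h (expC h ^ (i + 1)) (expC h) a * qb h (expC h ^ (- i)) 1 b))).
  move=> h ah; rewrite opT1; [|exact: expC_neq0|exact: admissible_expr_neq1].
  by rewrite -mulrA coefs_in_cM coefs_in_xy expC_int.
apply: near_boundedM; first exact: expands_bounded (expands_expC _).
apply: near_boundedM.
  apply: (@near_bounded_qbin 1 (i + 1)%:~R 1) => h; rewrite mul1r ?expC_int //.
  by rewrite mulr1.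
apply: (@near_bounded_qbin 1 (- i)%:~R 0) => h; rewrite mul1r ?expC_int //.
by rewrite mulr0 expC0.
Qed.

(** The weight and the left factor have poles in h, so they cannot be estimated separately.
    Induction on the total degree through [opT_rec] involves only the bounded coefficients of
    [opT j 1]. *)
Lemma fps_expands_opT F i : fps_expands F 0 0 -> fps_expands (fun h => T h i (F h)) 0 0.
Proof.
move=> HF a b; have [n] := ubnP (a + b); elim: n => // n IH in i F HF a b *.
rewrite ltnS => abn.
apply: (@expands_ext _ (fun h => F h 0%N 0%N * T h i 1 a b +
    ((if a is a'.+1 then T h (i + 1) (shift_x (F h)) a' b else 0) +
     (if b is b'.+1 then T h (i - 1) (shift_y (F h)) a b' else 0)))).
  by move=> h _; rewrite -opT_rec.
have -> : (0 : S2) a b = 0 + (0 + 0) by rewrite !addr0.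
apply: expandsD; first exact: expands0M (HF 0%N 0%N) (near_bounded_opT1 _ _ _).
apply: expandsD.
  case: a abn => [|a] abn; first exact: expands_cst.
  by apply: IH => // a' b'; exact: HF.
case: b abn => [|b] abn; first exact: expands_cst.
apply: IH; last by rewrite addnS in abn.
by move=> [|a'] b' /=; [exact: HF | exact: expands_cst].
Qed.

End Families.

(** * The first-order matrix *)

Section FirstOrder.
Variable K : numFieldType.
Variables m1 m2 m3 m4 : K.
Local Notation S2 := (fps (fps K)).
Local Notation bb := (binom_fps (-1 : K)).
Local Notation x := (vx K).
Local Notation y := (vy K).

Definition up_coef (i : int) : K := (i%:~R + m1) * (i%:~R + m2).
Definition down_coef (i : int) : K := (i%:~R - m3) * (i%:~R - m4).

(* 1 / (1 - L) *)
Definition geomL : S2 := Fps (fun a => Fps (fun b => (a == b)%:R)).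

Lemma geomLK : (1 - x * y) * geomL = 1.
Proof.
apply: fps2P => -[|a] [|b]; rewrite mulrBl mul1r coefs2D coefs2N -mulrA coefs_vxM
  ?coefs_vyM /= ?subr0 //.
by rewrite eqSS subrr.
Qed.

(** Row i of the first-order matrix, divided by x^i. *)
Definition rho (i : int) : S2 :=
  in_c (i * (i + 1))%:~R +
  geomL * (- in_c (up_coef i) * x - in_c (down_coef i) * y + in_c (up_coef i +
    down_coef i) * (x * y)).

(** Since [geomL] is a series in L, only monomials with a - b in {-1, 0, 1} appear. The factor 1 - L
    in u + d - (u + d)/(1 - L) leaves the off-diagonal series untouched: each of x/(1 - L), y/(1 -
    L), L/(1 - L) has coefficients 0 or 1. *)
Lemma rhoE i a b : rho i a b =
  ((a == 0) && (b == 0))%:R * (i * (i + 1))%:~R - (a == b.+1)%:R * up_coef i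
  - (b == a.+1)%:R * down_coef i + ((a == b) && (0 < b))%N%:R * (up_coef i +
    down_coef i).
Proof.
have H0 c : (in_c c : S2) a b = ((a == 0) && (b == 0))%N%:R * c.
  by case: a b => [|a] [|b] /=; rewrite ?mul1r ?mul0r.
have H1 : (x * geomL) a b = (a == b.+1)%:R by rewrite coefs_vxM; case: (a).
have H2 : (y * geomL) a b = (b == a.+1)%:R.
  by rewrite coefs_vyM; case: (b) => //= b'; rewrite eqSS eq_sym.
have H3 : (x * (y * geomL)) a b = ((a == b) && (0 < b))%N%:R.
  by rewrite coefs_vxM; case: (a) => [|a']; [case: (b) | rewrite coefs_vyM;
    case: (b) => //= b'; rewrite eqSS andbT].
have -> : rho i = in_c (i * (i + 1))%:~R + (- (in_c (up_coef i) * (x * geomL))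
  - in_c (down_coef i) * (y * geomL) + in_c (up_coef i + down_coef i) * (x * (y *
    geomL))).
  by rewrite /rho; ring.
transitivity ((in_c (i * (i + 1))%:~R : S2) a b + (- (in_c (up_coef i) * (x * geomL))
  a b
  - (in_c (down_coef i) * (y * geomL)) a b + (in_c (up_coef i + down_coef i) * (x *
    (y * geomL))) a b)).
  by [].
have K1 : (in_c (up_coef i) * (x * geomL)) a b = up_coef i * (a == b.+1)%:R.
  by rewrite -H1; exact: coefs_in_cM.
have K2 : (in_c (down_coef i) * (y * geomL)) a b = down_coef i * (b == a.+1)%:R.
  by rewrite -H2; exact: coefs_in_cM.
have K3 : (in_c (up_coef i + down_coef i) * (x * (y * geomL))) a b =
    (up_coef i + down_coef i) * ((a == b) && (0 < b))%N%:R.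
  by rewrite -H3; exact: coefs_in_cM.
transitivity (((a == 0) && (b == 0))%N%:R * (i * (i + 1))%:~R +
    (- (up_coef i * (a == b.+1)%:R) - down_coef i * (b == a.+1)%:R +
     (up_coef i + down_coef i) * ((a == b) && (0 < b))%N%:R)); last by ring.
by congr (_ + (- _ - _ + _)).
Qed.

(** The common limit (1 + x)^(-i) (1 + y)^i of S_i and U_i. *)
Definition lead_fps (i : int) : S2 := in_x (bb i%:~R) * in_y (bb (- i%:~R)).

(** After multiplication by 1 + x this is x(1 + y) - xy(1 + x) = x(1 - xy). *)
Lemma x_identity : geomL * (x * in_x (bb 1) * (1 + y) - x * y) = x * in_x (bb 1).
Proof.
have X1 : (1 + x) * in_x (bb 1) = 1.
  by have := congr1 (@in_x K) (binom_fps1K K); rewrite rmorphM rmorphD !rmorph1.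
transitivity ((1 - x * y) * geomL * (x * in_x (bb 1))); last by rewrite geomLK mul1r.
have -> : x * in_x (bb 1) * (1 + y) - x * y =
   x * in_x (bb 1) * (1 + y) - x * y * ((1 + x) * in_x (bb 1)) by rewrite X1 mulr1.
by ring.
Qed.

Lemma y_identity : geomL * (y * in_y (bb 1) * (1 + x) - x * y) = y * in_y (bb 1).
Proof.
have Y1 : (1 + y) * in_y (bb 1) = 1.
  by have := congr1 (@in_y K) (binom_fps1K K); rewrite rmorphM rmorphD !rmorph1.
transitivity ((1 - x * y) * geomL * (y * in_y (bb 1))); last by rewrite geomLK mul1r.
have -> : y * in_y (bb 1) * (1 + x) - x * y =
   y * in_y (bb 1) * (1 + x) - x * y * ((1 + y) * in_y (bb 1)) by rewrite Y1 mulr1.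
by ring.
Qed.

Lemma lead_fps_up i : lead_fps (i + 1) = lead_fps i * (in_x (bb 1) * (1 + y)).
Proof.
rewrite /lead_fps rmorphD /= opprD -!binom_fpsM binom_fpsN1 !(rmorphM, rmorphD,
  rmorph1).
by rewrite -/y; ring.
Qed.

Lemma lead_fps_down i : lead_fps (i - 1) = lead_fps i * (in_y (bb 1) * (1 + x)).
Proof.
rewrite /lead_fps rmorphB /= opprB addrC -!binom_fpsM binom_fpsN1 !(rmorphM, rmorphD,
  rmorph1).
by rewrite -/x; ring.
Qed.

(** The term (u + d) L is what makes the denominator 1 - L cancel, by [x_identity] for u and
    [y_identity] for d. *)
Lemma first_order i :
  in_c (i * (i + 1))%:~R * lead_fps i +
  geomL * (- in_c (up_coef i) * x * lead_fps (i + 1) - in_c (down_coef i) * y *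
    lead_fps (i - 1)
           + in_c (up_coef i + down_coef i) * (x * y) * lead_fps i) =
  lead_fps i * (in_c (i * (i + 1))%:~R - in_c (up_coef i) * (x * in_x (bb 1)) - in_c
    (down_coef i) * (y * in_y (bb 1))).
Proof.
rewrite lead_fps_up lead_fps_down -x_identity -y_identity rmorphD.
by move: (lead_fps i) geomL => f g; ring.
Qed.

Lemma first_order_sub (f g u w d : S2) : w = f * d -> g = u + d ->
  f * g - (f * u + w) = 0.
Proof. by move=> -> ->; ring. Qed.

End FirstOrder.

(** * Comparison of S_i with U_i and expansion of the rows *)

Section Main.
Variable R : realType.
Variables m1 m2 m3 m4 : R[i].
Local Notation C := R[i].
Local Notation S2 := (fps (fps C)).
Local Notation bb := (binom_fps (-1 : C)).
Local Notation x := (vx C).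
Local Notation y := (vy C).
Local Notation al := (up_coef m1 m2).
Local Notation be := (down_coef m3 m4).

Local Notation S h i :=
  (serS (expC h) (expC (h * m1)) (expC (h * m2)) (expC (h * m3)) (expC (h * m4)) i).
Local Notation U h i := (serU (expC h) i).

Definition serS_rel (i : int) : S2 :=
  in_c (tri i)%:~R +
  (in_c (qbin_rel_coef (i%:~R + m1 + m2) m1) * (x * in_x (bb 1)) + in_c
    (qbin_rel_coef 0 m2) * (x * in_x (bb 1))) +
  (in_c (qbin_rel_coef (- i%:~R + m3 + m4) m3) * (y * in_y (bb 1)) + in_c
    (qbin_rel_coef 0 m4) * (y * in_y (bb 1))).

Lemma rel_expands_serS i : rel_expands (fun h => S h i) (lead_fps C i) (serS_rel i).
Proof.
(* The exponents i + m2 and -m2 add up to i, and likewise -i + m4 and -m4 to -i, so the limit is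
   independent of the m's. *)
have ->: lead_fps C i = 1 * (in_x (bb (i%:~R + m1 + m2 - m1)) * in_x (bb (0 - m2))) *
   (in_y (bb (- i%:~R + m3 + m4 - m3)) * in_y (bb (0 - m4))).
  rewrite mul1r -!rmorphM !binom_fpsM /lead_fps; congr (in_x (bb _) * in_y (bb _));
    ring.
rewrite /rel_expands; apply: (@fps_expands_ext _ (fun h => in_c (expC (h * (tri
  i)%:~R)) *
  (in_x (qbin (expC h) (qinv (expC h)) (- (expC h ^ i * expC (h * m1) * expC (h *
    m2))) (- expC (h * m1)))
   * in_x (qbin (expC h) (qinv (expC h)) (-1) (- expC (h * m2)))) *
  (in_y (qbin (expC h) (qinv (expC h)) (- (expC h ^ (- i) * expC (h * m3) * expC (h *
    m4))) (- expC (h * m3)))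
   * in_y (qbin (expC h) (qinv (expC h)) (-1) (- expC (h * m4)))))).
  by move=> h _; rewrite /serS !rmorphM expC_int.
apply: rel_expandsM; last first.
  apply: rel_expandsM; apply: rel_expands_qbin_y => h //.
    by rewrite !mulrDr !expCD -expC_int rmorphN.
  by rewrite mulr0 expC0.
apply: rel_expandsM; first exact: rel_expands_expC.
apply: rel_expandsM; apply: rel_expands_qbin_x => h //.
  by rewrite !mulrDr !expCD -expC_int.
by rewrite mulr0 expC0.
Qed.

Definition serU_rel (i : int) : S2 :=
  in_c (- tri i)%:~R + in_c (qbin_rel_coef 0 (- i%:~R)) * (x * in_x (bb 1)) +
  in_c (qbin_rel_coef 0 i%:~R) * (y * in_y (bb 1)).

Lemma rel_expands_serU i : rel_expands (fun h : C => U h i) (lead_fps C i) (serU_rel i).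
Proof.
have ->: lead_fps C i = 1 * in_x (bb (0 - - i%:~R)) * in_y (bb (0 - i%:~R)).
  by rewrite mul1r !sub0r opprK.
rewrite /rel_expands; apply: (@fps_expands_ext _ (fun h => in_c (expC (h * (- tri
  i)%:~R)) *
  in_x (qbin (expC h) (qinv (expC h)) (-1) (- expC h ^ (- i))) *
  in_y (qbin (expC h) (qinv (expC h)) (-1) (- expC h ^ i)))).
  by move=> h _; rewrite /serU expC_int.
apply: rel_expandsM; last first.
  by apply: rel_expands_qbin_y => h; rewrite ?mulr0 ?expC0 // expC_int.
apply: rel_expandsM; first exact: rel_expands_expC.
by apply: rel_expands_qbin_x => h; rewrite ?mulr0 ?expC0 // -expC_int rmorphN.
Qed.

(** The constant terms differ by 2 [tri i] = i(i + 1); the coefficients of x/(1 + x) and y/(1 + y)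
    differ by -u and -d, as polynomial identities. *)
Lemma serS_relE i : serS_rel i = serU_rel i +
  (in_c (i * (i + 1))%:~R - in_c (al i) * (x * in_x (bb 1)) - in_c (be i) * (y * in_y
    (bb 1))).
Proof.
rewrite /serS_rel /serU_rel.
have t2 : (i * (i + 1))%:~R = (tri i)%:~R * 2 :> C.
  by rewrite -tri_double rmorphM.
have r1 : qbin_rel_coef (i%:~R + m1 + m2) m1 + qbin_rel_coef 0 m2 = qbin_rel_coef 0
  (- i%:~R) - al i.
  by rewrite /qbin_rel_coef /up_coef; field.
have r2 : qbin_rel_coef (- i%:~R + m3 + m4) m3 + qbin_rel_coef 0 m4 = qbin_rel_coef 0
  i%:~R - be i.
  by rewrite /qbin_rel_coef /down_coef; field.
rewrite -!mulrDl -!rmorphD r1 r2 t2 rmorphN.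
move: (qbin_rel_coef 0 _) (qbin_rel_coef 0 _) (al i) (be i) (x * _) (y * _) => ? ? ?
  ? ? ?.
by rewrite !(rmorphB, rmorphN, rmorphM, rmorph_nat); ring.
Qed.

(** The first-order part is built from the exact series U_j instead of their limits, so that [opT]
    can be evaluated on it with no error term. *)
Definition serV (i : int) (h : C) : S2 :=
  U h i + in_c h * (in_c (i * (i + 1))%:~R * U h i +
    geomL C * (- in_c (al i) * x * U h (i + 1) - in_c (be i) * y * U h (i - 1)
           + in_c (al i + be i) * (x * y) * U h i)).

Lemma fps_expands_cstM (F : C -> S2) f f' (c : S2) : fps_expands F f f' ->
  fps_expands (fun h : C => c * F h) (c * f) (c * f').
Proof. by move=> H; have := fps_expandsM (fps_expands_cst c) H;
  rewrite mul0r addr0. Qed.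

Lemma fps_expands_hM (F : C -> S2) f f' : fps_expands F f f' ->
  fps_expands (fun h : C => in_c h * F h) 0 f.
Proof.
move=> H; have := fps_expandsM (fps_expands_in_c (expands_id R)) H.
by rewrite rmorph0 rmorph1 !mul0r mul1r add0r.
Qed.

Lemma fps_expandsN (F : C -> S2) f f' : fps_expands F f f' ->
  fps_expands (fun h => - F h) (- f) (- f').
Proof.
move=> /(fps_expands_cstM (-1)); rewrite !mulN1r; apply: fps_expands_ext => h _.
by rewrite mulN1r.
Qed.

Lemma fps_expands_eq (F : C -> S2) f f' g g' : fps_expands F f f' -> f = g ->
  f' = g' -> fps_expands F g g'.
Proof. by move=> ? <- <-. Qed.

Lemma serS_remainder i : fps_expands (fun h => S h i - serV i h) 0 0.
Proof.
have HS := rel_expands_serS i; have HU := rel_expands_serU i.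
have HW := fps_expands_hM (fps_expandsD (fps_expands_cstM (in_c (i * (i + 1))%:~R) HU)
  (fps_expands_cstM (geomL C) (fps_expandsD (fps_expandsD (fps_expands_cstM (- in_c
    (al i) * x) (rel_expands_serU (i + 1)))
     (fps_expandsN (fps_expands_cstM (in_c (be i) * y) (rel_expands_serU (i - 1)))))
     (fps_expands_cstM (in_c (al i + be i) * (x * y)) HU)))).
apply: (fps_expands_eq (fps_expandsD HS (fps_expandsN (fps_expandsD HU HW))));
  first by rewrite addr0 subrr.
exact: (first_order_sub (first_order m1 m2 m3 m4 i) (serS_relE i)).
Qed.

Lemma opT_serV i (h : C) : admissible h ->
  opT (expC h) i (serV i h) = 1 + in_c h * rho m1 m2 m3 m4 i.
Proof.
move=> ah; apply: (opT_first_order (expC_neq0 h) (admissible_expr_neq1 ah)).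
by move=> a b /negPf /= ->.
Qed.

(** S_i is [serV] plus O(h^2): the image of [serV] is exact, and [opT] preserves O(h^2). *)
Lemma expands_HS i a b :
  expands (fun h => opT (expC h) i (S h i) a b) ((1 : S2) a b) (rho m1 m2 m3 m4 i a b).
Proof.
have [r Br E] := fps_expands_opT i (serS_remainder i) a b.
exists r => // h ah; rewrite (opT_sub _ i _ (serV i h)) opT_serV //.
transitivity ((1 : S2) a b + (in_c h * rho m1 m2 m3 m4 i) a b +
              opT (expC h) i (S h i - serV i h) a b); first by [].
congr (_ + _ + _); first exact: coefs_in_cM.
by rewrite (E h ah) !coefs0 mulr0 !add0r.
Qed.

End Main.

Theorem proposition5p1 (R : realType) (m1 m2 m3 m4 : R[i]) :
  exists R1 : int -> int -> nat -> R[i],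
    [/\ (* R = 1 + h R1 + O(h^2), entrywise and coefficientwise in L *)
        forall (i j : int) (k : nat), exists M delta : R, 0 < delta /\
          forall h : R[i], `|expC h| < 1 -> `|h| < delta%:C ->
            `| HS_matrix (expC h) (expC (h * m1)) (expC (h * m2))
                 (expC (h * m3)) (expC (h * m4)) i j k
               - (id_matrix R[i] i j k + h * R1 i j k) |
              <= M%:C * `|h| ^+ 2,
        tridiagonal R1,
        (* generically infinite-dimensional *)
        (forall z : int, [/\ m1 <> z%:~R, m2 <> z%:~R,
                             m3 <> z%:~R & m4 <> z%:~R]) ->
          forall s : seq int, s != [::] -> ~ truncates_to R1 [in s]
      & forall m n : nat,
          m1 = - m%:R \/ m2 = - m%:R ->
          m3 = - n%:R \/ m4 = - n%:R ->
          truncates_to R1 [pred i : int | - n%:Z <= i <= m%:Z]].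
Proof.
exists (fun i j k => emb i (fun a b => rho m1 m2 m3 m4 i a b) j k); split.
- move=> i j k.
  have idE : id_matrix R[i] i j k = emb i (fun a b => (1 : fps (fps R[i])) a b) j k.
    by rewrite -xpow_emb /id_matrix /xpow eq_sym.
  have HE (h : R[i]) : `|expC h| < 1 ->
      HS_matrix (expC h) (expC (h * m1)) (expC (h * m2)) (expC (h * m3)) (expC (h *
        m4)) i j k =
      emb i (fun a b => opT (expC h) i (serS (expC h) (expC (h * m1)) (expC (h * m2))
        (expC (h * m3)) (expC (h * m4)) i) a b) j k.
    move=> qh; have q1 := expr_neq1 qh.
    by apply: HS_matrixE => //; [exact: expC_neq0 | apply: phiE => //;
      exact: expr_small].
  rewrite idE /emb in HE *; case: (j - i + k%:Z) HE => [n|n] HE; last first.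
    (* When j - i + k < 0, x^(j-i) L^k is not a monomial in x and L/x, so all three entries are
       zero. *)
    exists 0, 1; split=> // h qh _; rewrite HE // mulr0 addr0 subrr normr0.
    by rewrite mul0r.
  have [r [M [d [M0 d0 Hr]]] E] := expands_HS m1 m2 m3 m4 i n k.
  exists M, d; split=> // h qh hd; rewrite HE //.
  have ah : admissible h by move: qh; rewrite /admissible norm_cabs ltcE /= eqxx.
  rewrite E // addrAC subrr add0r normrM normrX mulrC.
  rewrite ler_wpM2r ?exprn_ge0 // norm_cabs lecR; apply: Hr => //.
  by move: hd; rewrite norm_cabs ltcR.
- move=> i j ij k; rewrite /emb; case E : (j - i + k%:Z) => [n|//].
  rewrite rhoE.
  have -> : (n == k.+1) = false by lia.
  have -> : (k == n.+1) = false by lia.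
  have -> : (n == k) = false by lia.
  have -> : ((n == 0) && (k == 0))%N = false by lia.
  by rewrite /= !mul0r !subr0 addr0.
- move=> mZ s s0 tr.
  (* At the largest index i of s, the entry (i, i + 1) at L^0 is -(i + m1)(i + m2), nonzero for
     non-integral m1 and m2. *)
  have [i iS imax] : exists2 i, i \in s & forall j, j \in s -> j <= i.
    case: s s0 {tr} => // a s _; elim: s a => [|b s IH] a.
      by exists a; rewrite ?mem_head // => j; rewrite inE => /eqP ->.
    have [i iS imax] := IH b; have [ai|ia] := leP a i.
      exists i; first by rewrite inE iS orbT.
      by move=> j; rewrite inE => /orP[/eqP -> //|/imax].
    exists a; first by rewrite mem_head.
    by move=> j; rewrite inE => /orP[/eqP -> //|/imax ji]; exact: le_trans ji (ltW ia).
  have jS : i + 1 \notin s by apply/negP => /imax; lia.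
  have := tr i (i + 1) iS jS 0%N; rewrite /emb.
  have -> : i + 1 - i + 0%N%:Z = 1%N by lia.
  rewrite rhoE /= !mul0r !mul1r sub0r subr0 addr0 => /eqP.
  rewrite oppr_eq0 mulf_eq0 !addr_eq0 => /orP[] /eqP E.
    by have [+ _ _ _] := mZ (- i); apply; rewrite rmorphN /= E opprK.
  by have [_ + _ _] := mZ (- i); apply; rewrite rmorphN /= E opprK.
move=> m n hm hn i j; rewrite !inE => /andP[ni im] jI k.
rewrite /emb; case E : (j - i + k%:Z) => [a|//]; rewrite rhoE.
(* By tridiagonality the block can be left only from i = m upwards or from i = -n downwards, and
   there the corresponding coefficient vanishes. *)
have up0 : i = m%:Z -> up_coef m1 m2 i = 0.
  by move=> ->; rewrite /up_coef; case: hm => ->; rewrite subrr ?mul0r ?mulr0.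
have dn0 : i = - n%:Z -> down_coef m3 m4 i = 0.
  by move=> ->; rewrite /down_coef rmorphN /=; case: hn => ->;
    rewrite subrr ?mul0r ?mulr0.
have -> : ((a == 0) && (k == 0))%N = false.
  by apply/negP => /andP[/eqP a0 /eqP k0]; move: jI; lia.
have -> : (a == k) = false by apply/negP => /eqP ak; move: jI; lia.
have -> : (a == k.+1)%:R * up_coef m1 m2 i = 0.
  case: eqP => [ak|_]; last by rewrite mul0r.
  by rewrite up0 ?mulr0 //; move: jI; lia.
have -> : (k == a.+1)%:R * down_coef m3 m4 i = 0.
  case: eqP => [ak|_]; last by rewrite mul0r.
  by rewrite dn0 ?mulr0 //; move: jI; lia.
by rewrite /= !mul0r !subr0 addr0.
Qed.
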